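(* Suppose the model $\mathcal M$ is conservative (and regular of Schur's class) on $\Omega=\mathbb T^n$. Let $(f,\mathbf u)$ be any weak solution of Leray-Hopf class (as defined in the context) of the system $$\begin{cases}\partial_t f + v\cdot\nabla_x f + \alpha\nabla_v\cdot\big(\mathrm{s}_\rho([\mathbf v]_\rho - v) f\big) = \beta\nabla_v\cdot\big((v-\mathbf u_\epsilon) f\big) + \sigma(\beta+\alpha \mathrm{s}_\rho)\Delta_v f,\\ \partial_t\mathbf u + (\mathbf u\cdot\nabla)\mathbf u + \nabla p = \nu\Delta\mathbf u + \gamma\int_{\mathbb R^n}\big((v-\mathbf u_\epsilon)f\big)_\epsilon\,dv,\\ \nabla\cdot\mathbf u=0\end{cases}$$ with initial data $f_0\in L^\infty\cap L^1_q$, $q\ge2$, $\mathbf u_0\in L^2(\Omega)$, $\nabla\cdot\mathbf u_0=0$. Then $\int_\Omega\rho\log\rho\,dx$ remains uniformly bounded in time, and there exist $c_1,c_2>0$ depending only on the initial condition and the parameters of the system such that, at all times, $$|\{\rho\ge c_1\}|\ge c_2 .$$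
   Context: Setting: $\alpha,\beta,\gamma,\nu,\sigma>0$ and $\epsilon>0$ are fixed; $g_\epsilon$ is the standard mollification of $g$ in $x$ at scale $\epsilon$. $f(t,x,v)\ge0$ is the particle distribution, with $\int f\,dv\,dx=1$; $\mathbf u,p$ are fluid velocity and pressure; $\rho=\int_{\mathbb R^n}f\,dv$, $\rho\mathbf v=\int_{\mathbb R^n}vf\,dv$. $|A|$ is the Lebesgue measure of $A\subset\Omega$. $\langle v\rangle=(1+|v|^2)^{1/2}$, $L^1_q=\{f:\int\langle v\rangle^q|f|\,dv\,dx<\infty\}$. Energy: $\mathcal E=\sigma\int_{\Omega\times\mathbb R^n}f\log\frac f\mu\,dv\,dx+\frac{\beta}{2\gamma}\int_\Omega|\mathbf u|^2dx$, $\mu=\frac1{|\Omega|(2\pi\sigma)^{n/2}}e^{-|v|^2/2\sigma}$. Fisher informations: $I_{vv}^{\mathbf g}=\int_{\Omega\times\mathbb R^n}\frac{|\sigma\nabla_vf+(v-\mathbf g)f|^2}{f}dv\,dx$, $I_{vv}^{\mathbf g,\mathrm{s}_\rho}=\int_{\Omega\times\mathbb R^n}\mathrm{s}_\rho\frac{|\sigma\nabla_vf+(v-\mathbf g)f|^2}{f}dv\,dx$. $\kappa_\rho=\rho\,\mathrm{s}_\rho\,dx$. Weak solution of Leray-Hopf class: a distributional solution attaining the initial data such that for all $T>0$, $f\in L^\infty([0,T);L^\infty\cap L^1_q)\cap C([0,T);\mathcal D'(\Omega\times\mathbb R^n))$, $|\nabla_vf|^2/f\in L^1([0,T)\times\Omega\times\mathbb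 R^n)$, $\mathbf u\in L^\infty([0,T);L^2)\cap L^2([0,T);H^1)\cap C([0,T);\mathcal D'(\Omega))$, and, in the distributional-in-time sense on $[0,\infty)$, $\frac{d}{dt}\mathcal E\le-\alpha I_{vv}^{\mathbf v,\mathrm{s}_\rho}-\beta I_{vv}^{\mathbf u_\epsilon}-\alpha\|\mathbf v\|^2_{L^2(\kappa_\rho)}+\alpha(\mathbf v,[\mathbf v]_\rho)_{L^2(\kappa_\rho)}-\frac{\beta\nu}{\gamma}\int_\Omega|\nabla\mathbf u|^2dx$. Such solutions exist for all such initial data. Environmental averaging models. Let $\mathcal P(\Omega)$ be the probability measures on $\Omega$. A model is a family $\mathcal M=\{(\mathrm{s}_\rho,[\cdot]_\rho):\rho\in\mathcal P(\Omega)\}$, where $\mathrm{s}_\rho\in C(\Omega)$, $\mathrm{s}_\rho\ge0$, and $[\cdot]_\rho$ are order-preserving bounded linear operators on $L^\infty(\rho)$ and $L^2(\rho)$ with $[1]_\rho=1$, such that $\mathbf w_\rho:=\mathrm{s}_\rho[\mathbf v]_\rho=\int_\Omega\phi_\rho(x,y)\mathbf v(y)\,d\rho(y)$ $\rho$-a.e., for a non-negative kernel $\phi_\rho\in L^1(d\rho\otimes d\rho)$ with $\int_\Omega\phi_\rho(x,y)\,d\rho(y)=\mathrm{s}_\rho(x)$ $\rho$-a.e. All models are local: there are $c_0,r_0>0$ with $\phi_\rho(x,y)\ge c_0$ for all $|x-y|<r_0$ and all $\rho\in\mathcal P(\Omega)$. Thickness: $\theta(\rho,x)=\int_\Omega\rho(x-r_0y)\chi(y)\,dy$,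 where $\chi\in C_0^\infty$ is a standard radially symmetric mollifier supported on the unit ball; $\theta(\rho,\Omega)=\inf_{x\in\Omega}\theta(\rho,x)$. $\mathcal M$ is regular if: (i) $\sup_{\rho\in\mathcal P(\Omega)}\|\mathrm{s}_\rho\|_\infty\le\overline S<\infty$; (ii) $\rho\mapsto\mathrm{s}_\rho$ is continuous from $L^1(\Omega)$ to $L^\infty(\Omega)$; (iii) $\mathrm{s}_\rho(x)\ge c\,\theta(\rho,x)$ for all $x\in\Omega$, with a constant $c>0$; (iv) for all densities $\rho,\rho',\rho''\in L^1(\Omega)$, $\|\partial_x^k\mathrm{s}_\rho\|_\infty+\|\partial_x^k\phi_\rho\|_\infty+\|\partial_y^k\phi_\rho\|_\infty\le C_k(\theta(\rho,\Omega))$ for $k=0,1,\dots$, and $\|\mathrm{s}_{\rho'}-\mathrm{s}_{\rho''}\|_\infty+\|\phi_{\rho'}-\phi_{\rho''}\|_\infty\le C(\theta(\rho',\Omega),\theta(\rho'',\Omega))\|\rho'-\rho''\|_1$. $\mathcal M$ is of Schur's class if: (v) $\sup_{\rho\in\mathcal P(\Omega)}\|\int_\Omega\phi_\rho(x,\cdot)\,d\rho(x)\|_\infty<\infty$; (vi) for any densities $\rho_n\to\rho$ in $L^1$ and any $|\tilde\rho_n|\le C\rho_n$, $|\tilde\rho|\le C\rho$ with $\tilde\rho_n\to\tilde\rho$ in $L^1$, $\int_\Omega\phi_{\rho_n}(x,\cdot)\tilde\rho_n(x)\,dx\to\int_\Omega\phi_\rho(x,\cdot)\tilde\rho(x)\,dx$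 weakly-* in $L^\infty(\rho)$. $\mathcal M$ is conservative if $\int_\Omega\phi_\rho(x,y)\,d\rho(x)=\mathrm{s}_\rho(y)$; equivalently $\int_\Omega\mathbf v\,d\kappa_\rho=\int_\Omega[\mathbf v]_\rho\,d\kappa_\rho$ for all $\rho\in\mathcal P(\Omega)$, $\mathbf v\in L^2(\kappa_\rho)$. *)

(* Defs.v *)
From HB Require Import structures.
From mathcomp Require Import all_boot all_order all_algebra.
From mathcomp Require Import all_classical all_reals all_analysis.
From mathcomp Require Import ess_sup_inf measurable_realfun.
Set Implicit Arguments. Unset Strict Implicit. Unset Printing Implicit Defensive.
Import Order.TTheory GRing.Theory Num.Theory numFieldNormedType.Exports.
Local Open Scope classical_set_scope. Local Open Scope ring_scope.

Definition rV_display : measure_display -> measure_display.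
Proof. exact. Qed.

Section measurable_rV.
Context {d : measure_display} {T : sigmaRingType d} (n : nat).

Let coord : 'I_n -> 'rV[T]_n -> T := fun i x => x ord0 i.

Let rV_set0 : g_sigma_preimage coord set0.
Proof. exact: sigma_algebra0. Qed.

Let rV_setC A : g_sigma_preimage coord A -> g_sigma_preimage coord (~` A).
Proof. exact: sigma_algebraC. Qed.

Let rV_bigcup (F : (set 'rV[T]_n)^nat) :
  (forall i, g_sigma_preimage coord (F i)) ->
  g_sigma_preimage coord (\bigcup_i F i).
Proof. exact: sigma_algebra_bigcup. Qed.

HB.instance Definition _ := @isMeasurable.Build (rV_display d)
  ('rV[T]_n) (g_sigma_preimage coord) rV_set0 rV_setC rV_bigcup.

End measurable_rV.

Lemma measurable_coord (R : realType) n (i : 'I_n) :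
  measurable_fun [set: 'rV[R]_n] (fun x => x ord0 i).
Proof.
move=> _ Y mY; rewrite setTI; apply: sub_sigma_algebra => /=.
rewrite -bigcup_seq/=; exists i => /=; first by rewrite mem_index_enum.
by exists Y => //; rewrite setTI.
Qed.

Lemma measurable_fun_rV (R : realType) d (T : measurableType d) n
    (f : T -> 'rV[R]_n) :
  (forall i, measurable_fun [set: T] (fun x => f x ord0 i)) ->
  measurable_fun [set: T] f.
Proof.
move=> mf _ A; rewrite setTI; move: A; apply: smallest_sub.
  split => /=.
  - by rewrite preimage_set0.
  - by move=> A mA; rewrite setTD preimage_setC; exact: measurableC.
  - by move=> F mF; rewrite preimage_bigcup; exact: bigcup_measurable.
rewrite -bigcup_seq; apply: bigcup_sub => i _ A [B mB <-].
rewrite setTI -comp_preimage -[X in measurable X]setTI.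
exact: mf.
Qed.

Section lebesgue_rV.
Context {R : realType}.

Definition consr n (z : measurableTypeR R * 'rV[R]_n) : 'rV[R]_n.+1 :=
  \row_i (if unlift ord0 i is Some j then z.2 ord0 j else z.1).

Lemma measurable_consr n : measurable_fun [set: _] (@consr n).
Proof.
apply: measurable_fun_rV => i.
case: (unliftP ord0 i) => [j|] ->.
- rewrite (_ : (fun _ => _) = (fun x : 'rV[R]_n => x ord0 j) \o snd).
    exact: measurableT_comp (measurable_coord j) measurable_snd.
  by apply/funext => z; rewrite /= mxE liftK.
- rewrite (_ : (fun _ => _) = fst); first exact: measurable_fst.
  by apply/funext => z; rewrite /= mxE unlift_none.
Qed.

Section step.
Context n (l : {sigma_finite_measure set (measurableTypeR R) -> \bar R})
  (m : {sigma_finite_measure set 'rV[R]_n -> \bar R}).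

Definition lebesgue_step : set 'rV[R]_n.+1 -> \bar R :=
  pushforward (l \x m)%E (@consr n).

Let step0 : lebesgue_step set0 = 0%E.
Proof. by rewrite /lebesgue_step /pushforward preimage_set0 measure0. Qed.

Let step_ge0 A : (0 <= lebesgue_step A)%E.
Proof. by rewrite /lebesgue_step /pushforward; exact: measure_ge0. Qed.

Let step_sigma_additive : semi_sigma_additive lebesgue_step.
Proof.
have mp A : measurable A -> measurable (@consr n @^-1` A).
  by move=> mA; rewrite -[X in measurable X]setTI; exact: measurable_consr.
move=> F mF tF mUF; rewrite /lebesgue_step /pushforward preimage_bigcup.
apply: measure_semi_sigma_additive.
- by move=> k; exact: mp.
- apply/trivIsetP => /= i j _ _ ij; rewrite -preimage_setI.
  by move/trivIsetP : tF => /(_ _ _ _ _ ij) ->//; rewrite preimage_set0.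
- by rewrite -preimage_bigcup; exact: mp.
Qed.

HB.instance Definition _ := isMeasure.Build _ _ _ lebesgue_step
  step0 step_ge0 step_sigma_additive.

Let step_sigma_finite : sigma_finite [set: 'rV[R]_n.+1] lebesgue_step.
Proof.
have /sigma_finiteP[F [FT ndF mF]] := sigma_finiteT l.
have /sigma_finiteP[G [GT ndG mG]] := sigma_finiteT m.
pose g (x : 'rV[R]_n.+1) : measurableTypeR R * 'rV[R]_n :=
  (x ord0 ord0, \row_j x ord0 (lift ord0 j)).
have mg : measurable_fun [set: _] g.
  apply/measurable_fun_pairP; split.
    exact: (measurable_coord (n := n.+1) ord0).
  apply: measurable_fun_rV => j.
  rewrite (_ : (fun _ => _) = (fun x : 'rV[R]_n.+1 => x ord0 (lift ord0 j))).
    exact: measurable_coord.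
  by apply/funext => x; rewrite /= mxE.
have gK : cancel (@consr n) g.
  move=> [a y]; rewrite /g /consr /= mxE unlift_none; congr pair.
  by apply/rowP => j; rewrite !mxE liftK.
exists (fun k => g @^-1` (F k `*` G k)).
  rewrite -preimage_bigcup (_ : \bigcup_k _ = setT) ?preimage_setT//.
  rewrite -subTset => -[x y] _.
  have [i _ Fx] : (\bigcup_i F i) x by rewrite -FT.
  have [j _ Gy] : (\bigcup_j G j) y by rewrite -GT.
  exists (maxn i j) => //; split.
  - by move: x Fx; exact/subsetPset/ndF/leq_maxl.
  - by move: y Gy; exact/subsetPset/ndG/leq_maxr.
move=> k; have [mFk Fk] := mF k; have [mGk Gk] := mG k; split.
  by rewrite -[X in measurable X]setTI; apply: mg => //; exact: measurableX.
rewrite /lebesgue_step /pushforward -comp_preimage.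
rewrite (_ : g \o _ = id) ?preimage_id; last by apply/funext => z /=.
by rewrite product_measure1E// lte_mul_pinfty// ge0_fin_numE.
Qed.

HB.instance Definition _ :=
  Measure_isSigmaFinite.Build _ _ _ lebesgue_step step_sigma_finite.

End step.

Fixpoint lebesgue_rV n : {sigma_finite_measure set 'rV[R]_n -> \bar R} :=
  match n with
  | 0%N => \d_(0 : 'rV[R]_0)
  | n'.+1 => lebesgue_step lebesgue_measure (lebesgue_rV n')
  end.

Lemma measurable_box n (A : 'I_n -> set R) : (forall i, measurable (A i)) ->
  measurable [set x : 'rV[R]_n | forall i, A i (x ord0 i)].
Proof.
move=> mA; rewrite (_ : [set _ | _] = \bigcap_(i in [set: 'I_n])
    (fun x : 'rV[R]_n => x ord0 i) @^-1` A i); last first.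
  apply/seteqP; split => x /= h i; [move=> _|]; first exact: h.
  exact: h i I.
apply: fin_bigcap_measurable => [|i _]; first exact: finite_finset.
by rewrite -[X in measurable X]setTI; exact: measurable_coord.
Qed.

Lemma lebesgue_rV_box n (A : 'I_n -> set R) : (forall i, measurable (A i)) ->
  (lebesgue_rV n [set x : 'rV[R]_n | forall i, A i (x ord0 i)] =
   \prod_(i < n) lebesgue_measure (A i))%E.
Proof.
elim: n => [|n IH] in A * => mA.
  by rewrite big_ord0 /= diracE mem_set// => -[].
rewrite big_ord_recl -IH => [|i]; last exact: mA.
rewrite /= /lebesgue_step /pushforward.
have mB : measurable
    [set y : 'rV[R]_n | forall j, A (lift ord0 j) (y ord0 j)].
  exact: (measurable_box (fun j => mA (lift ord0 j))).
transitivity ((@lebesgue_measure R \x lebesgue_rV n)%E (A ord0 `*`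
    [set y : 'rV[R]_n | forall j, A (lift ord0 j) (y ord0 j)])).
  congr (_ _); apply/seteqP; split => [[a y] h|[a y] [ha hy] i] /=.
    split => [|j] /=; first by have := h ord0; rewrite mxE unlift_none.
    by have := h (lift ord0 j); rewrite mxE liftK.
  by rewrite mxE; case: (unliftP ord0 i) => [j|] ->; [exact: hy|exact: ha].
exact: (product_measure1E lebesgue_measure (lebesgue_rV n) (mA ord0) mB).
Qed.

End lebesgue_rV.


Section calculus.
Context {R : realType}.

Definition iter_derive (V : normedModType R) (ds : seq V) (g : V -> R) : V -> R :=
  foldr (fun d h x => 'D_d h x) g ds.

(* C^oo: Frechet differentiability of all iterated directional derivatives
   forces them to be continuous *)
Definition smooth (V : normedModType R) (g : V -> R) :=
  forall (ds : seq V) (x : V), differentiable (iter_derive ds g) x.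

(* sup norm of the k-th differential, as a symmetric k-linear form *)
Definition ck_norm (V : normedModType R) (k : nat) (g : V -> R) : \bar R :=
  ereal_sup [set z | exists (ds : k.-tuple V) (x : V),
    (forall i, `|tnth ds i| <= 1) /\ z = `|iter_derive ds g x|%:E].

Definition sup_norm (T : Type) (g : T -> R) : \bar R :=
  ereal_sup (range (fun x => `|g x|%:E)).

Context {n : nat}.
Local Notation E := 'rV[R]_n.

Definition dot (x y : E) : R := \sum_(i < n) x ord0 i * y ord0 i.
Definition enorm (x : E) : R := Num.sqrt (dot x x).

Definition partial (i : 'I_n) (g : E -> R) (x : E) : R :=
  'D_(delta_mx ord0 i) g x.
Definition grad (g : E -> R) (x : E) : E := \row_i partial i g x.
Definition laplacian (g : E -> R) (x : E) : R :=
  \sum_(i < n) partial i (partial i g) x.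

Definition standard_mollifier (chi : E -> R) :=
  [/\ smooth chi, forall x, 0 <= chi x,
      forall x y, enorm x = enorm y -> chi x = chi y,
      forall x, 1 <= enorm x -> chi x = 0 &
      (\int[lebesgue_rV n]_x (chi x)%:E = 1)%E].

Definition mollify (chi : E -> R) (eps : R) (g : E -> R) (x : E) : R :=
  \int[lebesgue_rV n]_y (g (x - eps *: y) * chi y).

End calculus.

(* The torus (R / L Z)^n: a function on it is an L-periodic function on R^n,
   and its Borel sets and measures are those of the fundamental cell *)
Section torus.
Context {R : realType} {n : nat} (L : R).
Local Notation E := 'rV[R]_n.

Definition cell : set E := [set x | forall i, 0 <= x ord0 i < L].

Definition lattice (k : 'rV[int]_n) : E := \row_i (L * (k ord0 i)%:~R).

Definition periodic (T : Type) (g : E -> T) :=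
  forall k x, g (x + lattice k) = g x.

(* the geodesic distance on the torus between x and y is less than r *)
Definition torus_near (r : R) (x y : E) :=
  exists k, enorm (x - y - lattice k) < r.

Definition vol : R := fine (lebesgue_rV n cell).

Definition on_torus (P : probability E R) := P cell = 1%E.

Definition is_density (r : E -> R) :=
  [/\ measurable_fun setT r, periodic r, forall x, 0 <= r x &
      (\int[lebesgue_rV n]_(x in cell) (r x)%:E = 1)%E].

Lemma measurable_cell : measurable cell.
Proof.
rewrite (_ : cell =
    [set x : E | forall i : 'I_n, `[0, L[%classic (x ord0 i)]).
  by apply: (measurable_box (A := fun=> `[0, L[%classic)) => i.
by apply/seteqP; split => x /= h i; have := h i; rewrite /= in_itv.
Qed.

Section density.
Context (r : E -> R) (hr : is_density r).

Definition density_measure (A : set E) : \bar R :=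
  (\int[lebesgue_rV n]_(x in A `&` cell) (r x)%:E)%E.

Let density0 : density_measure set0 = 0%E.
Proof. by rewrite /density_measure set0I integral_set0. Qed.

Let density_ge0 A : (0 <= density_measure A)%E.
Proof.
by case: hr => _ _ r0 _; apply: integral_ge0 => x _; rewrite lee_fin r0.
Qed.

Let density_sigma_additive : semi_sigma_additive density_measure.
Proof.
move=> F mF tF mUF; have [mr _ r0 _] := hr.
have mrE (A : set E) : measurable_fun A (EFin \o r).
  by apply/measurable_EFinP; exact: measurable_funTS.
have mFI k : measurable (F k `&` cell).
  by apply: measurableI => //; exact: measurable_cell.
rewrite /density_measure setI_bigcupl ge0_integral_bigcup//.
- by apply: is_cvg_ereal_nneg_natsum => k _; exact: density_ge0.
- by move=> x _; rewrite lee_fin.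
- exact: trivIset_setIr.
Qed.

HB.instance Definition _ := isMeasure.Build _ _ _ density_measure
  density0 density_ge0 density_sigma_additive.

Let densityT : density_measure [set: E] = 1%E.
Proof. by case: hr => _ _ _ r1; rewrite /density_measure setTI. Qed.

HB.instance Definition _ :=
  Measure_isProbability.Build _ _ _ density_measure densityT.

Definition density_probability : probability E R := density_measure.

End density.

(* the probability r dx when r is a density, a dummy value otherwise *)
Definition law (r : E -> R) : probability E R :=
  if pselect (is_density r) is left hr then density_probability hr
  else \d_(0 : E).

Lemma lawE r A : is_density r ->
  law r A = (\int[lebesgue_rV n]_(x in A `&` cell) (r x)%:E)%E.
Proof. by rewrite /law; case: pselect. Qed.

Definition L1_dist (r r' : E -> R) : R :=
  \int[lebesgue_rV n]_(x in cell) `|r x - r' x|.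

End torus.

Section averaging.
Context {R : realType} {n : nat} {L : R}.
Local Notation E := 'rV[R]_n.
Local Notation Om := (@cell R n L).
Local Notation leb := (@lebesgue_rV R n).

(* [em_avg P] acts on representatives of classes in L^2(P).
   Since P is finite, L^oo(P) is contained in L^2(P). *)
Record averaging_model := AveragingModel {
  em_s : probability E R -> E -> R ;
  em_phi : probability E R -> E -> E -> R ;
  em_avg : probability E R -> (E -> R) -> E -> R ;
  em_c0 : R ;
  em_r0 : R ;
  em_chi : E -> R ;
  em_s_continuous : forall P, on_torus L P -> continuous (em_s P) ;
  em_s_periodic : forall P, on_torus L P -> periodic L (em_s P) ;
  em_s_ge0 : forall P, on_torus L P -> forall x, 0 <= em_s P x ;
  em_avg_bounded : forall P p, on_torus L P -> p = 2%:E \/ p = +oo%E ->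
    (forall w, w \in Lfun P p -> em_avg P w \in Lfun P p) /\
    (exists C : R, forall w, w \in Lfun P p ->
      (Lnorm P p (EFin \o em_avg P w) <= C%:E * Lnorm P p (EFin \o w))%E) ;
  em_avg_linear : forall P a w w', on_torus L P ->
    w \in Lfun P 2%:E -> w' \in Lfun P 2%:E ->
    {ae P, forall x, em_avg P (fun y => a * w y + w' y) x =
                     a * em_avg P w x + em_avg P w' x} ;
  em_avg_le : forall P w w', on_torus L P ->
    w \in Lfun P 2%:E -> w' \in Lfun P 2%:E ->
    {ae P, forall x, w x <= w' x} ->
    {ae P, forall x, em_avg P w x <= em_avg P w' x} ;
  em_avg1 : forall P, on_torus L P -> {ae P, forall x, em_avg P (cst 1) x = 1} ;
  em_phi_periodic : forall P, on_torus L P ->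
    (forall y, periodic L (em_phi P ^~ y)) /\
    (forall x, periodic L (em_phi P x)) ;
  em_phi_ge0 : forall P, on_torus L P -> forall x y, 0 <= em_phi P x y ;
  em_phi_integrable : forall P, on_torus L P ->
    (P \x P)%E.-integrable setT (fun z => (em_phi P z.1 z.2)%:E) ;
  em_phi_s : forall P, on_torus L P ->
    {ae P, forall x, (\int[P]_y (em_phi P x y)%:E = (em_s P x)%:E)%E} ;
  em_phi_avg : forall P w, on_torus L P -> w \in Lfun P 2%:E ->
    {ae P, forall x, ((em_s P x * em_avg P w x)%:E =
                      \int[P]_y (em_phi P x y * w y)%:E)%E} ;
  em_c0_gt0 : 0 < em_c0 ;
  em_r0_gt0 : 0 < em_r0 ;
  em_local : forall P, on_torus L P ->
    forall x y, torus_near L em_r0 x y -> em_c0 <= em_phi P x y ;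
  em_chi_mollifier : standard_mollifier em_chi
}.

Variable M : averaging_model.

(* For P = r dx this is the integral over R^n of r (x - r0 y) chi(y) dy,
   written after the substitution z = x - r0 y, and folding R^n onto the cell,
   so as to make sense for all measures *)
Definition theta (P : probability E R) (x : E) : R :=
  fine ((em_r0 M ^- n)%:E * \int[P]_(z in Om)
    \esum_(k in [set: 'rV[int]_n])
      (em_chi M ((em_r0 M)^-1 *: (x - z - lattice L k)))%:E)%E.

Definition thickness (P : probability E R) : R := inf (range (theta P)).

Definition regular :=
  [/\ exists S : R, forall P, on_torus L P -> (sup_norm (em_s M P) <= S%:E)%E,
      forall r, is_density L r -> forall e : R, 0 < e ->
        exists2 d : R, 0 < d & forall r', is_density L r' -> L1_dist L r r' < d ->
          (sup_norm (em_s M (law L r) \- em_s M (law L r'))%R <= e%:E)%E,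
      exists2 c : R, 0 < c & forall P, on_torus L P ->
        forall x, c * theta P x <= em_s M P x,
      exists C : nat -> R -> R, forall r, is_density L r ->
        let P := law L r in 0 < thickness P ->
        [/\ smooth (em_s M P), forall y, smooth (em_phi M P ^~ y),
            forall x, smooth (em_phi M P x) &
            forall k, (ck_norm k (em_s M P) +
              ereal_sup (range (fun y => ck_norm k (em_phi M P ^~ y))) +
              ereal_sup (range (fun x => ck_norm k (em_phi M P x))) <=
              (C k (thickness P))%:E)%E] &
      exists C : R -> R -> R, forall r r', is_density L r -> is_density L r' ->
        let P := law L r in let P' := law L r' in
        0 < thickness P -> 0 < thickness P' ->
        (sup_norm (em_s M P \- em_s M P')%R +
         sup_norm (fun z : E * E => em_phi M P z.1 z.2 - em_phi M P' z.1 z.2)%R <=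
         (C (thickness P) (thickness P') * L1_dist L r r')%:E)%E].

Definition weakstar_cvg (P : probability E R) (F_ : nat -> E -> R) (F : E -> R) :=
  [/\ forall k, F_ k \in Lfun P +oo%E, F \in Lfun P +oo%E &
      forall g, g \in Lfun P 1%:E ->
        (fun k => \int[P]_y (F_ k y * g y)) @ \oo --> \int[P]_y (F y * g y)].

Definition schur_class :=
  (exists S : R, forall P, on_torus L P ->
    (ess_sup P (fun y => \int[P]_x (em_phi M P x y)%:E) <= S%:E)%E) /\
  (forall (r_ : nat -> E -> R) (r : E -> R) (g_ : nat -> E -> R) (g : E -> R)
      (C : R),
    (forall k, is_density L (r_ k)) -> is_density L r ->
    L1_dist L (r_ k) r @[k --> \oo] --> 0 ->
    (forall k, measurable_fun setT (g_ k)) -> measurable_fun setT g ->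
    (forall k, {ae leb, forall x, Om x -> `|g_ k x| <= C * r_ k x}) ->
    {ae leb, forall x, Om x -> `|g x| <= C * r x} ->
    L1_dist L (g_ k) g @[k --> \oo] --> 0 ->
    weakstar_cvg (law L r)
      (fun k y => \int[leb]_(x in Om) (em_phi M (law L (r_ k)) x y * g_ k x))
      (fun y => \int[leb]_(x in Om) (em_phi M (law L r) x y * g x))).

Definition conservative := forall P, on_torus L P ->
  {ae P, forall y, (\int[P]_x (em_phi M P x y)%:E = (em_s M P y)%:E)%E}.

Definition avg_vec (P : probability E R) (w : E -> E) (x : E) : E :=
  \row_i em_avg M P (fun y => w y ord0 i) x.

End averaging.
Arguments averaging_model : clear implicits.

Record params (R : realType) (n : nat) := Params {
  alpha : R ; beta : R ; gamma : R ; nu : R ; sigma : R ; eps : R ;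
  eta : 'rV[R]_n -> R ;
  alpha_gt0 : 0 < alpha ; beta_gt0 : 0 < beta ; gamma_gt0 : 0 < gamma ;
  nu_gt0 : 0 < nu ; sigma_gt0 : 0 < sigma ; eps_gt0 : 0 < eps ;
  eta_mollifier : standard_mollifier eta
}.

Section system.
Context {R : realType} {n : nat} {L : R}.
Local Notation E := 'rV[R]_n.
Local Notation Om := (@cell R n L).
Local Notation Ph := (@cell R n L `*` [set: E]).
Local Notation leb1 := (@lebesgue_measure R).
Local Notation leb := (@lebesgue_rV R n).
Local Notation leb2 := (@lebesgue_rV R n \x @lebesgue_rV R n)%E.
Variables (M : averaging_model R n L) (pr : params R n).
Implicit Types (h : E -> E -> R) (w : E -> E).

Definition rho h (x : E) : R := \int[leb]_v h x v.

(* the value at points where the density vanishes is irrelevant *)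
Definition mean_velocity h (x : E) : E :=
  (rho h x)^-1 *: \row_i \int[leb]_v (v ord0 i * h x v).

Definition law_of h : probability E R := law L (rho h).

Definition strength h : E -> R := em_s M (law_of h).

Definition avg_velocity h : E -> E := avg_vec M (law_of h) (mean_velocity h).

Definition mollify_vec w (x : E) : E :=
  \row_i mollify (eta pr) (eps pr) (fun y => w y ord0 i) x.

Definition fluid_force h w (x : E) : E :=
  \row_i \int[leb]_v
    mollify (eta pr) (eps pr)
      (fun y => (v - mollify_vec w y) ord0 i * h y v) x.

Definition maxwellian (v : E) : R :=
  (vol (n := n) L * (2 * pi * sigma pr) `^ (n%:R / 2))^-1 *
  expR (- (dot v v / (2 * sigma pr))).

Definition energy h w : R :=
  sigma pr * \int[leb2]_(z in Ph)
    (h z.1 z.2 * ln (h z.1 z.2 / maxwellian z.2)) +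
  beta pr / (2 * gamma pr) * \int[leb]_(x in Om) dot (w x) (w x).

(* G stands for the weak v-gradient of h; the integrand is 0 where h = 0 *)
Definition fisher (s : E -> R) h (G : E -> E -> E) (g : E -> E) : R :=
  \int[leb2]_(z in Ph)
    (let F := sigma pr *: G z.1 z.2 + h z.1 z.2 *: (z.2 - g z.1) in
     s z.1 * (dot F F / h z.1 z.2)).

Definition kappa_dot h (a b : E -> E) : R :=
  \int[leb]_(x in Om) (dot (a x) (b x) * (rho h x * strength h x)).

(* H i stands for the weak i-th partial derivative of the fluid velocity w *)
Definition dissipation h (G : E -> E -> E) w (H : 'I_n -> E -> E) : R :=
  alpha pr * fisher (strength h) h G (mean_velocity h) +
  beta pr * fisher (cst 1) h G (mollify_vec w) +
  alpha pr * kappa_dot h (mean_velocity h) (mean_velocity h) -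
  alpha pr * kappa_dot h (mean_velocity h) (avg_velocity h) +
  beta pr * nu pr / gamma pr *
    \int[leb]_(x in Om) (\sum_(i < n) dot (H i x) (H i x)).

Definition test_txv (psi : R * E * E -> R) :=
  [/\ smooth psi, forall t v, periodic L (fun x => psi (t, x, v)) &
      exists a b, 0 < a /\ forall t x v, psi (t, x, v) != 0 ->
        a <= t <= b /\ enorm v <= b].

Definition test_tx_on (a b : R) (psi : R * E -> R) :=
  [/\ smooth psi, forall t, periodic L (fun x => psi (t, x)) &
      forall t x, psi (t, x) != 0 -> a <= t <= b].

Definition test_tx (psi : R * E -> R) :=
  exists a b, 0 < a /\ test_tx_on a b psi.

Definition test_xv (psi : E * E -> R) :=
  [/\ smooth psi, forall v, periodic L (fun x => psi (x, v)) &
      exists b, forall x v, psi (x, v) != 0 -> enorm v <= b].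

Definition test_x (psi : E -> R) := smooth psi /\ periodic L psi.

(* distributions on (0, +oo) x Omega *)
Definition is_distribution (p : (R * E -> R) -> R) :=
  (forall c psi psi', test_tx psi -> test_tx psi' ->
    p (fun z => c * psi z + psi' z) = c * p psi + p psi') /\
  (forall a b, 0 < a -> exists (C : R) (k : nat),
    forall psi, test_tx_on a b psi ->
      (`|p psi|%:E <= C%:E * \sum_(j < k) ck_norm j psi)%E).

Implicit Types (f : R -> E -> E -> R) (u : R -> E -> E).

(* The coefficients depend on f t through choices of representatives made
   independently at each time, whence the iterated integrals *)
Definition kinetic_eq f u := forall psi, test_txv psi ->
  \int[leb1]_(t in `[0, +oo[) \int[leb2]_(z in Ph)
    (let x := z.1 in let v := z.2 in
     let grad_v := grad (fun v' => psi (t, x, v')) v in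
     f t x v *
     (derive1 (fun t' => psi (t', x, v)) t
      + dot v (grad (fun x' => psi (t, x', v)) x)
      + alpha pr * strength (f t) x * dot (avg_velocity (f t) x - v) grad_v
      - beta pr * dot (v - mollify_vec (u t) x) grad_v
      + sigma pr * (beta pr + alpha pr * strength (f t) x) *
        laplacian (fun v' => psi (t, x, v')) v)) = 0.

(* the pressure is the distribution p *)
Definition fluid_eq f u (H : 'I_n -> R -> E -> E) :=
  exists2 p, is_distribution p &
  forall Psi : 'I_n -> R * E -> R, (forall i, test_tx (Psi i)) ->
  \int[leb1]_(t in `[0, +oo[) \int[leb]_(x in Om)
    (let Psi_x := \row_i Psi i (t, x) : E in
     dot (u t x) (\row_i derive1 (fun t' => Psi i (t', x)) t)
     - dot (\sum_(i < n) u t x ord0 i *: H i t x) Psi_x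
     + nu pr * dot (u t x) (\row_i laplacian (fun x' => Psi i (t, x')) x)
     + gamma pr * dot (fluid_force (f t) (u t) x) Psi_x)
  + p (fun z => \sum_(i < n) partial i (fun x' => Psi i (z.1, x')) z.2) = 0.

Definition divergence_free_eq u := forall psi, test_tx psi ->
  \int[leb1]_(t in `[0, +oo[) \int[leb]_(x in Om)
    dot (u t x) (grad (fun x' => psi (t, x')) x) = 0.

Definition weak_grad_v f (G : R -> E -> E -> E) :=
  [/\ measurable_fun [set z : R * E * E | 0 <= z.1.1]
        (fun z => G z.1.1 z.1.2 z.2),
      forall (T : R) i, (\int[leb1]_(t in `[0%R, T[)
        \int[leb2]_(z in Om `*` [set v | (enorm v <= T)%R])
          `|G t z.1 z.2 ord0 i|%:E < +oo)%E &
      forall psi i, test_txv psi ->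
        \int[leb1]_(t in `[0, +oo[) \int[leb2]_(z in Ph)
          (f t z.1 z.2 * partial i (fun v' => psi (t, z.1, v')) z.2) =
        - (\int[leb1]_(t in `[0, +oo[) \int[leb2]_(z in Ph)
             (G t z.1 z.2 ord0 i * psi (t, z.1, z.2)))].

Definition weak_partial_x u (i : 'I_n) (Hi : R -> E -> E) :=
  measurable_fun [set z : R * E | 0 <= z.1] (fun z => Hi z.1 z.2) /\
  forall psi j, test_tx psi ->
    \int[leb1]_(t in `[0, +oo[) \int[leb]_(x in Om)
      (u t x ord0 j * partial i (fun x' => psi (t, x')) x) =
    - (\int[leb1]_(t in `[0, +oo[) \int[leb]_(x in Om)
         (Hi t x ord0 j * psi (t, x))).

Definition energy_ineq (f0 : E -> E -> R) (u0 : E -> E) f (G : R -> E -> E -> E)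
    u (H : 'I_n -> R -> E -> E) :=
  forall phi : R -> R, smooth phi -> (forall t, 0 <= t -> 0 <= phi t) ->
    (exists b, forall t, b < t -> phi t = 0) ->
    (- (\int[leb1]_(t in `[0, +oo[) (energy (f t) (u t) * derive1 phi t))
     - energy f0 u0 * phi 0)
    <= - (\int[leb1]_(t in `[0, +oo[)
            (dissipation (f t) (G t) (u t) (fun i => H i t) * phi t)).

Definition norm_Lq (q : R) h : \bar R :=
  (\int[leb2]_(z in Ph)
    ((1 + dot z.2 z.2) `^ (q / 2) * `|h z.1 z.2|)%:E)%E.

Definition unit_mass h := (\int[leb2]_(z in Ph) (h z.1 z.2)%:E = 1)%E.

Record initial_data (q : R) (f0 : E -> E -> R) (u0 : E -> E) : Prop := {
  id_f_measurable : measurable_fun setT (fun z : E * E => f0 z.1 z.2) ;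
  id_f_periodic : periodic L f0 ;
  id_f_ge0 : forall x v, 0 <= f0 x v ;
  id_f_mass : unit_mass f0 ;
  id_f_Loo : exists C : R, {ae leb2, forall z, f0 z.1 z.2 <= C} ;
  id_f_L1q : (norm_Lq q f0 < +oo)%E ;
  id_u_measurable : measurable_fun setT u0 ;
  id_u_periodic : periodic L u0 ;
  id_u_L2 : (\int[leb]_(x in Om) (dot (u0 x) (u0 x))%:E < +oo)%E ;
  id_u_div : forall psi, test_x psi ->
    \int[leb]_(x in Om) dot (u0 x) (grad psi x) = 0
}.

Record leray_hopf_solution (q : R) (f0 : E -> E -> R) (u0 : E -> E) f u : Prop := {
  lh_f_measurable : measurable_fun [set z : R * E * E | 0 <= z.1.1]
    (fun z => f z.1.1 z.1.2 z.2) ;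
  lh_f_periodic : forall t, 0 <= t -> periodic L (f t) ;
  lh_f_ge0 : forall t x v, 0 <= t -> 0 <= f t x v ;
  lh_f_mass : forall t, 0 <= t -> unit_mass (f t) ;
  lh_u_measurable : measurable_fun [set z : R * E | 0 <= z.1]
    (fun z => u z.1 z.2) ;
  lh_u_periodic : forall t, 0 <= t -> periodic L (u t) ;
  lh_u_L1 : forall t i, 0 <= t ->
    leb.-integrable Om (fun x => (u t x ord0 i)%:E) ;
  lh_f_init : {ae leb2, forall z, f 0 z.1 z.2 = f0 z.1 z.2} ;
  lh_u_init : {ae leb, forall x, u 0 x = u0 x} ;
  lh_f_Loo : forall T : R, 0 < T -> exists C : R, {ae leb1, forall t, 0 <= t < T ->
    {ae leb2, forall z, f t z.1 z.2 <= C} /\ (norm_Lq q (f t) <= C%:E)%E} ;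
  lh_f_continuous : forall (T : R) psi, 0 < T -> test_xv psi ->
    {within `[0, T[, continuous
      (fun t => \int[leb2]_(z in Ph) (f t z.1 z.2 * psi z))} ;
  lh_u_LooL2 : forall T : R, 0 < T -> exists C : R, {ae leb1, forall t, 0 <= t < T ->
    (\int[leb]_(x in Om) (dot (u t x) (u t x))%:E <= C%:E)%E} ;
  lh_u_continuous : forall (T : R) psi i, 0 < T -> test_x psi ->
    {within `[0, T[, continuous
      (fun t => \int[leb]_(x in Om) (u t x ord0 i * psi x))} ;
  lh_kinetic : kinetic_eq f u ;
  lh_div : divergence_free_eq u ;
  lh_weak_derivatives : exists (G : R -> E -> E -> E) (H : 'I_n -> R -> E -> E),
    [/\ weak_grad_v f G /\ (forall i, weak_partial_x u i (H i)),
        forall T : R, 0 < T -> (\int[leb1]_(t in `[0%R, T[) \int[leb2]_(z in Ph)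
          (dot (G t z.1 z.2) (G t z.1 z.2) / f t z.1 z.2)%:E < +oo)%E,
        forall T : R, 0 < T -> (\int[leb1]_(t in `[0%R, T[) \int[leb]_(x in Om)
          (\sum_(i < n) dot (H i t x) (H i t x))%:E < +oo)%E,
        fluid_eq f u H &
        energy_ineq f0 u0 f G u H]
}.

End system.

(* Main.v *)
Require Import Defs.
From HB Require Import structures.
From mathcomp Require Import all_boot all_order all_algebra.
From mathcomp Require Import all_classical all_reals all_analysis.
From mathcomp Require Import measurable_realfun.
From mathcomp Require Import ring lra.
Set Implicit Arguments. Unset Strict Implicit. Unset Printing Implicit Defensive.
Import Order.TTheory GRing.Theory Num.Theory numFieldNormedType.Exports.
Local Open Scope classical_set_scope.
Local Open Scope ring_scope.

(** The total energy is a relative entropy plus a kinetic energy, and for a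
conservative model it cannot increase.  In the dissipation every term is
visibly nonnegative except the alignment term
[alpha * (|v|^2 - (v, [v]))] in [L^2(kappa)].  That one is nonnegative because
[s [v]] is the integral operator of a nonnegative kernel both of whose
marginals are [s]: one marginal by definition of a model, the other by
conservativity.  Bounding [v(x) . v(y)] by half the sum of the squares and
integrating the kernel out gives the claim ([averaging_contraction],
[dissipation_ge0]).

The energy inequality is distributional in time, hence gives
[E(t) <= E(0)] for almost every [t] only.  To reach every [t], the entropy is
replaced by its dual form: with [mu] the Maxwellian,
[\int f ln (f / mu) >= \int f Psi + 1 - \int mu e^Psi] for every bounded
[Psi], which is the integral of the Legendre inequality
[a ln a >= a (y + 1) - e^y].  For a test function [Psi] the right-hand side is
continuous in [t], because [f] is continuous in time with values in the
distributions; testing the energy inequality with a smooth cutoff whose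
derivative is concentrated just after [t] then yields the bound at [t]
itself ([le_of_decay], [gibbs_bound]).

Taking [Psi] to depend on [x] only, up to a cutoff in [v] that is sent to
infinity, leaves [\int rho psi + 1 <= H + G \int e^psi] on the torus, where
[H] is the initial energy over [sigma] and [G] the integral of the Maxwellian
in [v].  Periodic test functions approximate bounded measurable ones in
[L^1((1 + rho) dx)] ([approximable_measurable]), so [psi] may increase to the
positive part of [ln rho].  Since [e^psi <= 1 + rho] along the way, this gives
[\int rho (ln rho)_+ <= H + G (1 + |Omega|) - 1] ([positive_entropy_bound]),
uniformly in time and with constants that depend on the data only; from below
[\int rho ln rho >= - |Omega|].

Finally let [K] be positive and at least that bound.  The part of the mass where [rho] is
below [1 / (4 |Omega|)] is at most [1/4], and so is the part where [rho] is
above [e^(4 K)], because there [rho <= rho ln rho / (4 K)].  Half of the mass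
therefore lies where [rho] is between the two thresholds, which forces that
set to have measure at least [e^(- 4 K) / 2] ([level_set_lower_bound]). *)

(** * Integration on the torus *)

Section arbitrary_integrands.
Local Open Scope ereal_scope.
Context d (T : measurableType d) (R : realType) (mu : {measure set T -> \bar R}).
Import HBNNSimple.

(** The integral of a nonnegative function is a supremum over the simple
functions below it, and a simple function may be cut off on a null set without
changing its integral: this is why arbitrary functions can be compared. *)
Lemma le_integralT_ae_ge0 (f g : T -> \bar R) :
  (forall x, 0 <= f x) -> (forall x, 0 <= g x) ->
  {ae mu, forall x, f x <= g x} -> \int[mu]_x f x <= \int[mu]_x g x.
Proof.
move=> f0 g0 [N [mN N0 fgN]]; rewrite (ge0_integralTE mu f0) (ge0_integralTE mu g0).
apply: ge_ereal_sup => _ [h /= hf <-].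
have mNC : measurable (~` N) by exact: measurableC.
apply: ereal_sup_ubound; exists (proj_nnsfun h mNC) => /= [x|].
  rewrite mindicE; have [xN|xN] := boolP (x \in ~` N); last by rewrite mulr0.
  rewrite mulr1; apply: (le_trans (hf x)); move: xN; rewrite inE => xN.
  by apply: contrapT => /fgN.
rewrite -!integralT_nnsfun; apply: ge0_ae_eq_integral => //.
- by apply/measurable_EFinP.
- by apply/measurable_EFinP.
- by move=> x _; rewrite lee_fin mulr_ge0.
- by move=> x _; rewrite lee_fin.
- exists N; split => // x /= nh; apply: contrapT => xN; apply: nh => _.
  by rewrite mindicE mem_set// mulr1.
Qed.

(** Energy and dissipation involve representatives chosen at each time
separately, so that nothing is known about their measurability in time; hence
a comparison for arbitrary integrands. *)
Lemma le_integral_ae (D : set T) (f g : T -> \bar R) :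
  {ae mu, forall x, D x -> f x <= g x} ->
  \int[mu]_(x in D) f x <= \int[mu]_(x in D) g x.
Proof.
move=> fg; rewrite !(integral_mkcond D) integralE [leRHS]integralE.
have {}fg : {ae mu, forall x, (f \_ D) x <= (g \_ D) x}.
  apply: filterS fg => x h; rewrite !patchE; case: ifPn => //.
  by rewrite inE => /h.
apply: leeB; apply: le_integralT_ae_ge0 => //; apply: filterS fg => x fg.
  by rewrite !funeposE ge_max le_max fg /= le_max lexx orbT.
by rewrite !funenegE ge_max le_max leeN2 fg /= le_max lexx orbT.
Qed.

Lemma le_integral_pointwise (D : set T) (f g : T -> \bar R) :
  (forall x, D x -> f x <= g x) ->
  \int[mu]_(x in D) f x <= \int[mu]_(x in D) g x.
Proof. by move=> fg; apply: le_integral_ae; exact: aeW. Qed.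

End arbitrary_integrands.

Section rV_measurability.
Context {R : realType} {n : nat}.
Local Notation E := 'rV[R]_n.

(** The sigma-algebra of [R^n] is generated by the coordinates; it contains the
open sets because an open set is a countable union of rational cubes. *)
Lemma open_measurable_rV (A : set E) : open A -> measurable A.
Proof.
move=> oA.
pose B (p : 'rV[rat]_n * nat) : set E :=
  [set x | forall i, ball (ratr (p.1 ord0 i) : R) (p.2.+1%:R^-1) (x ord0 i)].
have -> : A = \bigcup_(p in [set p | B p `<=` A]) B p.
  apply/seteqP; split => [x Ax|x [p /= BA]]; last exact: BA.
  have /nbhs_ballP[e /= e0 xA] := oA _ Ax.
  have [k ke] : exists k : nat, k.+1%:R^-1 < e / 2.
    exists (Num.truncn (2 / e)); rewrite invf_plt ?posrE ?divr_gt0//.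
    by rewrite invf_div truncnS_gt.
  have /choice[q hq] : forall i : 'I_n,
      exists q : rat, ball (ratr q : R) (k.+1%:R^-1) (x ord0 i).
    move=> i; have := @rat_in_itvoo R (x ord0 i - k.+1%:R^-1) (x ord0 i + k.+1%:R^-1).
    rewrite ltrD2l gtrN// => /(_ isT)[q]; rewrite in_itv/= => /andP[q1 q2].
    exists q; rewrite /ball/= ltr_norml; apply/andP; split.
      by rewrite ltrBrDr addrC; exact: q1.
    by rewrite ltrBlDr addrC; exact: q2.
  exists (\row_i q i, k) => /= [y By|i] /=; last by rewrite mxE; exact: hq.
  apply: xA; split => [//|i j]; rewrite ord1; have := By j; have := hq j.
  rewrite /= mxE /ball /= => xq yq.
  rewrite (le_lt_trans (ler_distD (ratr (q j)) _ _))// [e]splitr ltrD//.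
    by rewrite distrC; apply: lt_trans xq ke.
  by apply: lt_trans yq ke.
rewrite bigcup_mkcond; apply: countable_bigcupT_measurable => // p.
case: ifPn => // _; apply: (measurable_box (A := fun i =>
  ball (ratr (p.1 ord0 i) : R) (p.2.+1%:R^-1))) => i; exact: measurable_ball.
Qed.

Lemma continuous_measurable_rV (g : E -> R) :
  continuous g -> measurable_fun setT g.
Proof.
move=> /continuousP cg; apply: (measurability _ (RGenOpens.measurableE R)).
move=> _ [_ [a [b ->] <-]]; rewrite setTI; apply: open_measurable_rV.
exact/cg/interval_open.
Qed.

End rV_measurability.

Section torus_integration.
Context {R : realType} {n : nat} {L : R}.
Local Notation E := 'rV[R]_n.
Local Notation Om := (@cell R n L).
Local Notation leb := (@lebesgue_rV R n).
Hypothesis L_gt0 : 0 < L.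

Lemma lebesgue_cell : leb Om = (L ^+ n)%:E.
Proof.
rewrite (_ : Om = [set x : E | forall i : 'I_n, `[0, L[%classic (x ord0 i)]).
  rewrite (lebesgue_rV_box (A := fun=> `[0, L[%classic))//.
  rewrite (eq_bigr (fun=> L%:E)) => [|i _].
    by rewrite prodEFin big_const_ord iter_mulr_1.
  by rewrite lebesgue_measure_itv/= lte_fin L_gt0 -EFinB subr0.
by apply/seteqP; split => x /= h i; have := h i; rewrite /= in_itv.
Qed.

Lemma volE : vol (n := n) L = L ^+ n.
Proof. by rewrite /vol lebesgue_cell. Qed.

Lemma vol_gt0 : 0 < vol (n := n) L.
Proof. by rewrite volE exprn_gt0. Qed.

End torus_integration.

Section law_integral.
Local Open Scope ereal_scope.
Context {R : realType} {n : nat} {L : R}.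
Local Notation E := 'rV[R]_n.
Local Notation Om := (@cell R n L).
Local Notation leb := (@lebesgue_rV R n).
Variable r : E -> R.
Hypothesis dr : is_density L r.
Import HBNNSimple.

Lemma on_torus_law : on_torus L (law L r).
Proof.
rewrite /on_torus lawE// setIid; by have [] := dr.
Qed.

Let mrE : measurable_fun setT (EFin \o r).
Proof. by apply/measurable_EFinP; have [] := dr. Qed.

Let r0 x : 0 <= (r x)%:E.
Proof. by rewrite lee_fin; have [_ _ ->] := dr. Qed.

(** Both sides agree on simple functions by definition of the measure, and both
pass to increasing limits. *)
Lemma ge0_integral_law (f : E -> \bar R) :
  measurable_fun setT f -> (forall x, 0 <= f x) ->
  \int[law L r]_x f x = \int[leb]_(x in Om) (f x * (r x)%:E).
Proof.
move=> mf f0.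
pose h := nnsfun_approx measurableT mf.
have fE x : f x = limn (EFin \o h^~ x).
  by apply/esym/cvg_lim => //; exact: cvg_nnsfun_approx.
transitivity (limn (fun k => \int[law L r]_x (EFin \o h k) x)).
  under eq_integral => x _ do rewrite fE.
  apply: monotone_convergence => //.
  - by move=> k; exact/measurable_EFinP.
  - by move=> k x _; rewrite lee_fin.
  - by move=> x _ a b ab; rewrite lee_fin; exact/lefP/nd_nnsfun_approx.
transitivity (limn (fun k => \int[leb]_(x in Om) ((h k x)%:E * (r x)%:E))); last first.
  have fg x : f x * (r x)%:E = limn (fun k => (h k x)%:E * (r x)%:E).
    by apply/esym/cvg_lim => //; apply: cvgeZr => //; exact: cvg_nnsfun_approx.
  under [RHS]eq_integral => x _ do rewrite fg.
  apply/esym/monotone_convergence => //.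
  - exact: measurable_cell.
  - move=> k; apply: measurable_funTS; apply: emeasurable_funM => //.
    exact/measurable_EFinP.
  - by move=> k x _; rewrite mule_ge0// lee_fin.
  - move=> x _ a b ab; rewrite lee_wpmul2r// lee_fin; exact/lefP/nd_nnsfun_approx.
congr (limn _); apply/funext => k.
rewrite integralT_nnsfun sintegralE.
transitivity (\int[leb]_(x in Om)
   (\sum_(y \in range (h k)) (y * \1_(h k @^-1` [set y]) x)%:E * (r x)%:E)); last first.
  apply: eq_integral => x _; rewrite [in RHS]fimfunE -fsumEFin//.
  by rewrite ge0_mule_fsuml// => y; exact: nnfun_muleindic_ge0.
rewrite ge0_integral_fsum//; last 3 first.
- exact: measurable_cell.
- move=> y; apply: measurable_funTS; apply: emeasurable_funM => //.
  by apply/measurable_EFinP; exact: measurable_funM.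
- by move=> y x _; rewrite mule_ge0// nnfun_muleindic_ge0.
apply: eq_fsbigr => y yh.
under eq_integral => x _ do rewrite EFinM -muleA.
rewrite ge0_integralZl//; last 4 first.
- exact: measurable_cell.
- apply: measurable_funTS; apply: emeasurable_funM => //.
  by apply/measurable_EFinP; exact: measurable_indic.
- by move=> x _; rewrite mule_ge0// lee_fin.
- move: yh; rewrite inE => -[x _ <-]; by rewrite lee_fin.
congr (_ * _); transitivity (\int[leb]_(x in (h k @^-1` [set y]) `&` Om) (r x)%:E).
  exact: lawE.
rewrite setIC integral_mkcondr.
apply: eq_integral => x _; rewrite patchE indicE.
by case: ifPn => _; rewrite ?mul1e ?mul0e.
Qed.

End law_integral.

Lemma ae_mono d (T : measurableType d) (R : realType) (mu : {measure set T -> \bar R})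
  (P Q : T -> Prop) : (forall x, P x -> Q x) ->
  {ae mu, forall x, P x} -> {ae mu, forall x, Q x}.
Proof. by move=> PQ; apply: filterS. Qed.

Lemma ae_mono2 d (T : measurableType d) (R : realType) (mu : {measure set T -> \bar R})
  (P P' Q : T -> Prop) : (forall x, P x -> P' x -> Q x) ->
  {ae mu, forall x, P x} -> {ae mu, forall x, P' x} -> {ae mu, forall x, Q x}.
Proof. by move=> PQ; apply: filterS2. Qed.

(** * Smooth functions *)

Section smooth_calculus.
Context {R : realType}.
Implicit Types V W : normedModType R.

(** Smoothness asks for the differentiability of all iterated directional
derivatives, so a class of differentiable functions which is stable under
directional derivatives consists of smooth functions.  All the closure
properties below are obtained by exhibiting such a class. *)
Lemma smooth_coind V (P : (V -> R) -> Prop) :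
  (forall g, P g -> (forall x, differentiable g x) /\ forall d, P ('D_d g)) ->
  forall g, P g -> smooth g.
Proof.
move=> Pstep g Pg ds; elim/last_ind: ds g Pg => [|ds d IH] g Pg.
  by have [] := Pstep _ Pg.
rewrite /iter_derive foldr_rcons; apply: IH; exact: (Pstep _ Pg).2.
Qed.

Lemma smooth_differentiable V (g : V -> R) x : smooth g -> differentiable g x.
Proof. by move=> /(_ [::] x). Qed.

Lemma smooth_derive V (g : V -> R) d : smooth g -> smooth ('D_d g).
Proof. by move=> sg ds x; have := sg (rcons ds d) x; rewrite /iter_derive foldr_rcons. Qed.

Lemma smooth_continuous V (g : V -> R) : smooth g -> continuous g.
Proof. by move=> sg x; exact/differentiable_continuous/smooth_differentiable. Qed.

Lemma smooth_cst V (c : R) : smooth (cst c : V -> R).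
Proof.
apply: (@smooth_coind _ (fun g => exists c, g = cst c)); last by exists c.
move=> _ [a ->]; split=> [x|d]; first exact: differentiable_cst.
by exists 0; apply/funext => x; exact: derive_cst.
Qed.

Lemma smooth_linear V (f : {linear V -> R}) : continuous f -> smooth f.
Proof.
move=> cf.
have df x : differentiable f x by exact: linear_differentiable.
apply: (@smooth_coind _ (fun g => g = f \/ smooth g)); last by left.
move=> g [->|sg]; split=> [x|d].
- exact: df.
- right; rewrite (_ : 'D_d f = cst (f d)); first exact: smooth_cst.
  by apply/funext => x; rewrite deriveE// diff_lin.
- exact: smooth_differentiable.
- by right; exact: smooth_derive.
Qed.

Lemma smooth_precomp V W (l : {linear V -> W}) (g : W -> R) :
  continuous l -> smooth g -> smooth (g \o l).
Proof.
move=> cl sg; apply: (@smooth_coind _ (fun f => exists2 g, smooth g & f = g \o l)); last first.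
  by exists g.
move=> _ [{sg}g sg ->]; split=> [x|d].
  apply: differentiable_comp; first exact: linear_differentiable.
  exact: smooth_differentiable.
exists ('D_(l d) g); first exact: smooth_derive.
apply/funext => x; rewrite /derive.
rewrite (_ : (fun h => _) =
  (fun h => h^-1 *: ((g \o shift (l x)) (h *: l d) - g (l x))))//.
by apply/funext => h /=; rewrite linearP.
Qed.

Lemma diff_real (h : R -> R) (y a : R) : 'd h y a = a * 'd h y 1.
Proof. by rewrite -{1}[a]mulr1 -[a * 1]/(a *: 1) linearZ. Qed.

Lemma derive_real (h : R -> R) (y a : R) :
  differentiable h y -> 'D_a h y = a * 'D_1 h y.
Proof. by move=> dh; rewrite (deriveE a dh) (deriveE (1 : R) dh) diff_real. Qed.

Lemma derive_comp_real V (h : R -> R) (g : V -> R) x d :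
  differentiable g x -> differentiable h (g x) ->
  'D_d (h \o g) x = 'D_1 h (g x) * 'D_d g x.
Proof.
move=> dg dh; have dhg := differentiable_comp dg dh.
rewrite (deriveE d dhg) (deriveE d dg) (deriveE (1 : R) dh) diff_comp//= diff_real.
by rewrite mulrC.
Qed.

(** The derivative of a composition [h \o g] is a product of [h' \o g] and of a
derivative of [g]: products of compositions have to enter the class, and then
sums, for it to be stable under directional derivatives. *)
Inductive smooth_gen V : (V -> R) -> Prop :=
| SmoothGen g of smooth g : smooth_gen g
| SmoothAdd f g of smooth_gen f & smooth_gen g : smooth_gen (f + g)
| SmoothMul f g of smooth_gen f & smooth_gen g : smooth_gen (f * g)
| SmoothComp (h : R -> R) g of smooth h & smooth g : smooth_gen (h \o g).

Lemma smooth_gen_smooth V (g : V -> R) : smooth_gen g -> smooth g.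
Proof.
apply: smooth_coind => {}g; elim => {g}.
- move=> g sg; split=> [x|d]; first exact: smooth_differentiable.
  by apply: SmoothGen; exact: smooth_derive.
- move=> f g _ [df sf] _ [dg sg]; split=> [x|d]; first exact: differentiableD.
  rewrite (_ : 'D_d _ = 'D_d f + 'D_d g); first exact: SmoothAdd.
  by apply/funext => x; rewrite deriveD//; exact: diff_derivable.
- move=> f g gf [df sf] gg [dg sg]; split=> [x|d]; first exact: differentiableM.
  rewrite (_ : 'D_d _ = f * 'D_d g + g * 'D_d f).
    by apply: SmoothAdd; exact: SmoothMul.
  by apply/funext => x; rewrite deriveM//; exact: diff_derivable.
- move=> h g sh sg.
  have dh y : differentiable h y by exact: smooth_differentiable.
  have dg y : differentiable g y by exact: smooth_differentiable.
  split=> [x|d]; first exact: differentiable_comp.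
  rewrite (_ : 'D_d _ = ('D_1 h \o g) * 'D_d g).
    apply: SmoothMul; first by apply: SmoothComp => //; exact: smooth_derive.
    by apply: SmoothGen; exact: smooth_derive.
  by apply/funext => x; rewrite derive_comp_real.
Qed.

Lemma smoothD V (f g : V -> R) : smooth f -> smooth g -> smooth (f \+ g).
Proof. by move=> sf sg; apply/smooth_gen_smooth/SmoothAdd; exact: SmoothGen. Qed.

Lemma smoothM V (f g : V -> R) : smooth f -> smooth g -> smooth (f \* g).
Proof. by move=> sf sg; apply/smooth_gen_smooth/SmoothMul; exact: SmoothGen. Qed.

Lemma smooth_comp V (h : R -> R) (g : V -> R) : smooth h -> smooth g -> smooth (h \o g).
Proof. by move=> sh sg; apply/smooth_gen_smooth/SmoothComp. Qed.

Lemma smoothZ V (c : R) (f : V -> R) : smooth f -> smooth (fun x => c * f x).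
Proof. by move=> sf; apply: (smoothM (smooth_cst c) sf). Qed.

Lemma smoothN V (f : V -> R) : smooth f -> smooth (fun x => - f x).
Proof. by move=> /(smoothZ (-1)); under eq_fun do rewrite mulN1r. Qed.

Lemma smoothB V (f g : V -> R) : smooth f -> smooth g -> smooth (fun x => f x - g x).
Proof. by move=> sf /smoothN; exact: smoothD. Qed.

Lemma smooth_sum V (I : Type) (s : seq I) (f : I -> V -> R) :
  (forall i, smooth (f i)) -> smooth (fun x => \sum_(i <- s) f i x).
Proof.
move=> sf; elim: s => [|i s IH].
  by under eq_fun do rewrite big_nil; exact: smooth_cst.
by under eq_fun do rewrite big_cons; exact: smoothD.
Qed.

Lemma smooth_id : smooth (id : R -> R).
Proof.
apply: (@smooth_coind _ (fun g => g = id \/ smooth g)); last by left.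
move=> g [->|sg]; split=> [x|d].
- exact/derivable1_diffP/derivable_id.
- right; rewrite (_ : 'D_d id = cst d); first exact: smooth_cst.
  by apply/funext => x; rewrite derive_id.
- exact: smooth_differentiable.
- by right; exact: smooth_derive.
Qed.

Lemma smooth_primitive (f g : R -> R) :
  (forall x, derivable g x 1) -> (forall x, 'D_1 g x = f x) -> smooth f -> smooth g.
Proof.
move=> dg gf sf.
apply: (@smooth_coind _ (fun h => h = g \/ smooth h)); last by left.
move=> h [->|sh]; split=> [x|d].
- exact/derivable1_diffP.
- right; rewrite (_ : 'D_d g = fun x => d * f x); first exact: smoothZ.
  apply/funext => x.
  have dgx : differentiable g x by exact/derivable1_diffP.
  by rewrite -gf derive_real.
- exact: smooth_differentiable.
- by right; exact: smooth_derive.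
Qed.

Lemma smooth_sin : smooth (@sin R).
Proof.
apply: (@smooth_coind _ (fun g => exists a b, g = fun x => a * sin x + b * cos x)); last first.
  by exists 1, 0; apply/funext => x; rewrite mul1r mul0r addr0.
move=> _ [a [b ->]].
have D x : is_derive x (1 : R) (fun x => a * sin x + b * cos x) (a * cos x - b * sin x).
  by apply: is_derive_eq; rewrite /GRing.scale /=; ring.
have dD x : differentiable (fun x : R => a * sin x + b * cos x) x.
  by apply/derivable1_diffP.
split=> // d; exists (- (d * b)), (d * a); apply/funext => x.
rewrite derive_real// derive_val; ring.
Qed.

Lemma smooth_coord n (i : 'I_n) : smooth (fun x : 'rV[R]_n => x ord0 i).
Proof.
have @f : {linear 'rV[R]_n -> R}.
  by exists (fun N : 'rV[R]_n => N ord0 i); do 2![eexists]; do ?[constructor];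
     rewrite ?mxE// => ? *; rewrite ?mxE//; move=> ?; rewrite !mxE.
apply: (@smooth_linear _ f); exact: coord_continuous.
Qed.

Lemma smooth_fst V W (g : V -> R) : smooth g -> smooth (fun z : V * W => g z.1).
Proof. move=> sg; apply: (@smooth_precomp _ _ fst) => // x; exact: cvg_fst. Qed.

Lemma smooth_snd V W (g : W -> R) : smooth g -> smooth (fun z : V * W => g z.2).
Proof. move=> sg; apply: (@smooth_precomp _ _ snd) => // x; exact: cvg_snd. Qed.

Lemma smooth_dot n : smooth (fun x : 'rV[R]_n => dot x x).
Proof. by apply: smooth_sum => i; apply: smoothM; exact: smooth_coord. Qed.

Lemma smooth_line n (e : 'rV[R]_n) (g : 'rV[R]_n -> R) :
  smooth g -> smooth (fun s : R => g (s *: e)).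
Proof.
move=> sg.
have lin : linear ( *:%R ^~ e : R -> _) by move=> a b c; rewrite scalerDl scalerA.
pose sxL : {linear _ -> _} :=
  HB.pack ( *:%R ^~ e : R -> 'rV[R]_n) (GRing.isLinear.Build _ _ _ _ _ lin).
apply: (@smooth_precomp _ _ sxL) => //; exact: scalel_continuous.
Qed.

End smooth_calculus.

(** * A smooth step function *)

(** One such step serves three purposes: as a cutoff in time, as a cutoff in
velocity, and to approximate indicator functions of sets [{g > 0}]. *)
Record smooth_step (R : realType) (B : R -> R) : Prop := SmoothStep {
  step_smooth : smooth B ;
  step_left : forall s, s <= - 1 -> B s = 1 ;
  step_right : forall s, 1 <= s -> B s = 0 ;
  step_derive_le0 : forall s, derive1 B s <= 0 ;
  step_derive0 : forall s, 1 <= `|s| -> derive1 B s = 0 ;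
  step_itv : forall s, 0 <= B s <= 1
}.

Section smooth_step.
Context {R : realType}.

Lemma dotZ n (s : R) (x : 'rV[R]_n) : dot (s *: x) (s *: x) = s ^+ 2 * dot x x.
Proof. by rewrite /dot mulr_sumr; apply: eq_bigr => i _; rewrite !mxE; ring. Qed.

Lemma dot_ge0 n (x : 'rV[R]_n) : 0 <= dot x x.
Proof. by apply: sumr_ge0 => i _; rewrite -expr2 sqr_ge0. Qed.

Lemma dot_delta n (i : 'I_n) : dot (delta_mx ord0 i : 'rV[R]_n) (delta_mx ord0 i) = 1.
Proof.
rewrite /dot (bigD1 i)//= !mxE !eqxx mulr1 big1 ?addr0// => j ji.
by rewrite !mxE (negbTE ji) andbF mulr0.
Qed.

Lemma enorm_line n (i : 'I_n) (s : R) : enorm (s *: (delta_mx ord0 i : 'rV[R]_n)) = `|s|.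
Proof. by rewrite /enorm dotZ dot_delta mulr1 sqrtr_sqr. Qed.

(** By radial symmetry a mollifier vanishing on one coordinate axis would vanish
everywhere, against its integral being [1]. *)
Lemma mollifier_line_pos n (i : 'I_n) (chi : 'rV[R]_n -> R) :
  standard_mollifier chi -> exists s, chi (s *: delta_mx ord0 i) != 0.
Proof.
move=> [_ _ radial _ chi1]; apply: contrapT => h.
have chi0 x : chi x = 0.
  apply: contrapT => /eqP chix; apply: h; exists (enorm x).
  rewrite (radial _ x)// enorm_line ger0_norm// sqrtr_ge0//.
move: chi1; rewrite integral0_eq => [/esym/eqP|x _]; last by rewrite chi0.
by rewrite onee_eq0.
Qed.

(** The step is one minus the normalised primitive of the bump. *)
Lemma smooth_step_exists (b : R -> R) :
  smooth b -> (forall s, 0 <= b s) -> (forall s, 1 <= `|s| -> b s = 0) ->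
  (exists s, b s != 0) ->
  exists B : R -> R, smooth_step B.
Proof.
move=> sb b0 bsupp [s0 bs0].
have cb : continuous b by exact: smooth_continuous.
have mb : measurable_fun setT b by exact: continuous_measurable_fun.
have ib : (@lebesgue_measure R).-integrable setT (EFin \o b).
  have -> : EFin \o b = (EFin \o b) \_ `[- 1, 1]%classic.
    apply/funext => s; rewrite patchE; case: ifPn => // sN /=.
    rewrite bsupp// leNgt; apply: contra sN => s1.
    by rewrite inE/= in_itv/=; move: s1; rewrite ltr_norml => /andP[? ?]; apply/andP; split; lra.
  have i01 : (@lebesgue_measure R).-integrable `[- 1, 1] (EFin \o b).
    apply: continuous_compact_integrable; first exact: segment_compact.
    by apply: continuous_subspaceT.
  by apply: (iffLR (integrable_mkcond _ _)) i01.
pose F y := \int[lebesgue_measure]_(t in `]-oo, y]) b t.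
have iF y : (@lebesgue_measure R).-integrable `]-oo, y] (EFin \o b).
  by apply: integrableS ib.
have dF y : derivable F y 1 /\ derive1 F y = b y.
  apply: (@continuous_FTC1 _ _ -oo%O _ (y + 1)).
  - by rewrite ltrDl.
  - exact: iF.
  - by rewrite ltNyr.
  - exact: cb.
have D1F y : 'D_1 F y = b y by rewrite -derive1E; exact: (dF y).2.
have F0 y : 0 <= F y by exact: Rintegral_ge0.
have bN y : 1 <= y \/ y <= - 1 -> b y = 0.
  move=> h; apply: bsupp; rewrite ler_normr; apply/orP.
  by case: h => h; [left|right; rewrite lerNr].
have Flo y : y <= - 1 -> F y = 0.
  move=> y1; rewrite /F (@eq_Rintegral _ _ _ _ _ (cst 0)).
    by rewrite Rintegral_cst ?mul0r.
  move=> s; rewrite inE/= in_itv/= => sy.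
  by rewrite bN//; right; exact: le_trans y1.
pose c := \int[lebesgue_measure]_(t in setT) b t.
have Fhi y : 1 <= y -> F y = c.
  move=> y1; rewrite /F Rintegral_mkcond; congr (Rintegral _ _ _).
  apply/funext => s; rewrite patchE; case: ifPn => //.
  rewrite notin_setE/= in_itv/= => /negP; rewrite -ltNge => sy.
  by rewrite bN//; left; exact/ltW/(le_lt_trans y1).
have Fmono x y : x <= y -> F x <= F y.
  move=> xy; apply: (@ger0_derive1_ndecr _ F (x - 1) (y + 1)) => //.
  - by move=> z _; exact: (dF z).1.
  - by move=> z _; rewrite (dF z).2.
  - apply: continuous_subspaceT => z.
    apply/differentiable_continuous/derivable1_diffP; exact: (dF z).1.
  - by rewrite gerBl.
  - by rewrite lerDl.
have Fc y : F y <= c.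
  have [y1|y1] := leP 1 y; first by rewrite Fhi.
  by rewrite -(Fhi 1)//; apply: Fmono; exact: ltW.
have c0 : 0 < c.
  rewrite lt_neqAle -{2}(Fhi 1)// F0 andbT; apply/eqP => c0.
  have Fz y : F y = 0 by apply/eqP; rewrite eq_le F0 andbT c0.
  move/eqP : bs0; apply; rewrite -D1F (_ : F = cst 0) ?derive_cst//.
  exact/funext.
exists (fun s => 1 - c^-1 * F s).
have sF : smooth F.
  by apply: (smooth_primitive (f := b)) => // x; exact: (dF x).1.
have dB s : derive1 (fun s => 1 - c^-1 * F s) s = - (c^-1 * b s).
  rewrite derive1E.
  have dFs : derivable F s 1 := (dF s).1.
  have -> : (fun s => 1 - c^-1 * F s) = cst 1 - c^-1 *: F by [].
  rewrite deriveB//; last exact: derivableZ.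
  by rewrite derive_cst deriveZ// D1F sub0r.
split.
- by apply: smoothB; [exact: smooth_cst|exact: smoothZ].
- by move=> s s1; rewrite Flo// mulr0 subr0.
- by move=> s s1; rewrite Fhi// mulVf ?subrr// gt_eqF.
- by move=> s; rewrite dB oppr_le0 mulr_ge0// invr_ge0 ltW.
- by move=> s s1; rewrite dB bsupp// mulr0 oppr0.
- move=> s; have cV : 0 <= c^-1 by rewrite invr_ge0 ltW.
  rewrite subr_ge0 gerBl mulr_ge0// andbT.
  by rewrite mulrC ler_pdivrMr// mul1r.
Qed.

(** A smooth bump in one variable is obtained by restricting a mollifier to a
coordinate axis. *)
Lemma mollifier_smooth_step n (n_gt0 : (0 < n)%N) (chi : 'rV[R]_n -> R) :
  standard_mollifier chi ->
  exists B : R -> R, smooth_step B.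
Proof.
move=> mchi; have [schi chi0 _ chisupp _] := mchi.
pose e : 'rV[R]_n := delta_mx ord0 (Ordinal n_gt0).
apply: (@smooth_step_exists (fun s => chi (s *: e))).
- exact: smooth_line.
- by move=> s; exact: chi0.
- by move=> s s1; rewrite chisupp// enorm_line.
- exact: mollifier_line_pos mchi.
Qed.
End smooth_step.

(** * Approximation of measurable functions by periodic test functions *)

Section arc.
Context {R : realType} (L : R) (L_gt0 : 0 < L).

(** As a function of [y] each of the two sines changes sign after a period [L],
so their product is periodic; it is positive on the arc [0 < y < a] only. *)
Definition arc (a y : R) : R := sin (pi * y / L) * sin (pi * (a - y) / L).

Let pz : L != 0. Proof. by rewrite gt_eqF. Qed.

Lemma arc_periodic (a : R) (k : int) y : arc a (y + L * k%:~R) = arc a y.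
Proof.
have step z : arc a (z + L) = arc a z.
  rewrite /arc (_ : pi * (z + L) / L = pi * z / L + pi); last by field.
  rewrite (_ : pi * (a - (z + L)) / L = pi * (a - z) / L - pi); last by field.
  have sB w : sin (w - pi) = - sin w :> R by rewrite -[in RHS](subrK pi w) sinDpi opprK.
  by rewrite sinDpi sB mulrNN.
have nat_step (m : nat) z : arc a (z + L * m%:R) = arc a z.
  elim: m => [|m IH]; first by rewrite mulr0 addr0.
  by rewrite -natr1 mulrDr mulr1 addrA step IH.
case: k => m; first exact: nat_step.
by rewrite NegzE -[in RHS](nat_step m.+1 y) -(nat_step m.+1) mulrNz mulrN subrK.
Qed.

Lemma arc_gt0 (a y : R) : 0 < a <= L -> 0 <= y < L -> (0 < arc a y) = (0 < y < a).
Proof.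
move=> /andP[a0 aL] /andP[y0 yL].
have [->|yN0] := eqVneq y 0; first by rewrite /arc mulr0 mul0r sin0 mul0r ltxx.
have {}y0 : 0 < y by rewrite lt_neqAle eq_sym yN0.
rewrite y0 /= /arc pmulr_rgt0; last first.
  apply: sin_gt0_pi; rewrite divr_gt0 ?mulr_gt0 ?pi_gt0//=.
  by rewrite ltr_pdivrMr// ltr_pM2l ?pi_gt0.
have [ya|ay] := ltP y a.
  apply: sin_gt0_pi; rewrite divr_gt0 ?mulr_gt0 ?pi_gt0 ?subr_gt0//=.
  rewrite ltr_pdivrMr// ltr_pM2l ?pi_gt0//; lra.
apply/negbTE; rewrite -leNgt -oppr_ge0 -sinN; apply: sin_ge0_pi.
rewrite -mulNr -mulrN opprB divr_ge0 ?mulr_ge0 ?pi_ge0 ?subr_ge0//; last exact: ltW.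
by rewrite ler_pdivrMr// ler_pM2l ?pi_gt0//; lra.
Qed.

Lemma smooth_arc a : smooth (arc a).
Proof.
have sid := @smooth_id R.
apply: smoothM; apply: (@smooth_comp _ _ sin); try exact: smooth_sin.
  rewrite (_ : (fun _ => _) = (fun y => (pi / L) * y)); first exact: smoothZ.
  by apply/funext => y; field.
rewrite (_ : (fun _ => _) = (fun y => (pi / L) * (a - y))).
  by apply: smoothZ; apply: smoothB => //; exact: smooth_cst.
by apply/funext => y; field.
Qed.

End arc.

Section test_approximation.
Context {R : realType} {n : nat} {L : R}.
Hypothesis L_gt0 : 0 < L.
Local Notation E := 'rV[R]_n.
Local Notation Om := (@cell R n L).
Variable B : R -> R.
Hypothesis hB : smooth_step B.
Variable P : probability E R.

Lemma cvge0_small (u : nat -> \bar R) (e : R) :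
  u k @[k --> \oo] --> (0 : \bar R) -> 0 < e -> exists k, (u k <= e%:E)%E.
Proof.
move=> cu e0; apply: contrapT => /forallNP big.
have : (e%:E <= limn u)%E.
  apply: lime_ge; first by apply/cvg_ex; exists 0%E.
  by apply: nearW => N; apply/ltW; rewrite ltNge; apply/negP; exact: big.
by rewrite (cvg_lim _ cu)// lee_fin leNgt e0.
Qed.

(** The bound [K] on the approximants has to be uniform in the accuracy, because
their exponentials are integrated later on. *)
Definition L1_approx (K : R) (g : E -> R) := forall e, 0 < e ->
  exists psi : E -> R, [/\ test_x (L := L) psi, forall x, 0 <= psi x <= K &
    (\int[P]_(x in Om) `|g x - psi x|%:E <= e%:E)%E].

Let mOm : measurable Om := @measurable_cell R n L.

Lemma test_x_measurable (psi : E -> R) : test_x (L := L) psi -> measurable_fun setT psi.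
Proof. by move=> [s _]; apply: continuous_measurable_rV; exact: smooth_continuous. Qed.

Let mdist (g psi : E -> R) : measurable_fun setT g -> test_x (L := L) psi ->
  measurable_fun Om (fun x => `|g x - psi x|%:E).
Proof.
move=> mg /test_x_measurable mpsi; apply: measurable_funTS.
by apply/measurable_EFinP; apply: measurableT_comp => //; exact: measurable_funB.
Qed.

Lemma L1_approxD K1 K2 g1 g2 :
  measurable_fun setT g1 -> measurable_fun setT g2 ->
  L1_approx K1 g1 -> L1_approx K2 g2 -> L1_approx (K1 + K2) (g1 \+ g2).
Proof.
move=> mg1 mg2 a1 a2 e e0; have e20 : 0 < e / 2 by rewrite divr_gt0.
have [p1 [tp1 b1 i1]] := a1 _ e20; have [p2 [tp2 b2 i2]] := a2 _ e20.
exists (p1 \+ p2); split.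
- split; first by apply: smoothD; [exact: tp1.1|exact: tp2.1].
  by move=> k x; rewrite /= tp1.2 tp2.2.
- by move=> x; have /andP[? ?] := b1 x; have /andP[? ?] := b2 x; rewrite addr_ge0// lerD.
- rewrite [e]splitr EFinD; apply: (le_trans _ (leeD i1 i2)).
  rewrite -ge0_integralD//; [|exact: mdist|exact: mdist].
  apply: le_integral_pointwise => x _; rewrite -EFinD lee_fin /=.
  by rewrite opprD addrACA ler_normD.
Qed.

Lemma L1_approxZ c K g : 0 <= c -> measurable_fun setT g ->
  L1_approx K g -> L1_approx (c * K) (fun x => c * g x).
Proof.
move=> c0 mg ag e e0; have c10 : 0 < c + 1 by rewrite ltr_wpDl.
have [p [tp b i]] := ag (e / (c + 1)) (divr_gt0 e0 c10).
exists (fun x => c * p x); split.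
- split; first by apply: smoothZ; exact: tp.1.
  by move=> k x; rewrite /= tp.2.
- by move=> x; have /andP[? ?] := b x; rewrite mulr_ge0// ler_wpM2l.
- apply: (@le_trans _ _ (c%:E * (e / (c + 1))%:E)%E); last first.
    by rewrite -EFinM lee_fin mulrCA ger_pMr// ler_pdivrMr// mul1r lerDl.
  apply: le_trans (lee_wpmul2l _ i); last by rewrite lee_fin.
  rewrite -ge0_integralZl//; [|exact: mdist].
  by apply: le_integral_pointwise => x _; rewrite -EFinM lee_fin -mulrBr normrM ger0_norm.
Qed.

Definition approximable (A : set E) := measurable A /\ L1_approx 1 \1_A.

(** Only the trace of a set on the fundamental cell matters. *)
Lemma approximable_cell A A' : measurable A' -> A `&` Om = A' `&` Om ->
  approximable A -> approximable A'.
Proof.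
move=> mA' AA' [mA aA]; split=> // e e0; have [p [tp b i]] := aA _ e0.
exists p; split=> //; apply: le_trans i; apply: le_integral_pointwise => x Omx.
rewrite lee_fin (_ : \1_A' x = \1_A x :> R)//.
rewrite !indicE; congr ((_ : bool)%:R); apply/idP/idP; rewrite !inE => Ax.
  by have : (A `&` Om) x by [rewrite AA'; split]; case.
by have : (A' `&` Om) x by [rewrite -AA'; split]; case.
Qed.

Lemma approximable0 : approximable set0.
Proof.
split=> // e e0; exists (cst 0); split.
- by split=> //; exact: smooth_cst.
- by move=> x; rewrite lexx ler01.
- rewrite integral0_eq; first by rewrite lee_fin ltW.
  by move=> x _; rewrite indic0 subrr normr0.
Qed.

Lemma approximableC A : approximable A -> approximable (~` A).
Proof.
move=> [mA aA]; split; first exact: measurableC.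
move=> e /aA[p [[sp pp] b i]]; exists (fun x => 1 - p x); split.
- split; first by apply: smoothB => //; exact: smooth_cst.
  by move=> k x; rewrite /= pp.
- by move=> x; have := b x; lra.
- apply: le_trans i; apply: le_integral_pointwise => x _; rewrite lee_fin.
  rewrite distrC (_ : 1 - p x - \1_(~` A) x = \1_A x - p x)//.
  by rewrite !indicE in_setC; case: (x \in A); rewrite /=; ring.
Qed.

Lemma approximableI A A' : approximable A -> approximable A' -> approximable (A `&` A').
Proof.
move=> [mA aA] [mA' aA']; split; first exact: measurableI.
move=> e e0; have e20 : 0 < e / 2 by rewrite divr_gt0.
have [p1 [tp1 b1 i1]] := aA _ e20; have [p2 [tp2 b2 i2]] := aA' _ e20.
exists (p1 \* p2); split.
- split; first by apply: smoothM; [exact: tp1.1|exact: tp2.1].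
  by move=> k x; rewrite /= tp1.2 tp2.2.
- move=> x; have /andP[? ?] := b1 x; have /andP[? ?] := b2 x.
  by rewrite mulr_ge0//= mulr_ile1.
- rewrite [e]splitr EFinD; apply: (le_trans _ (leeD i1 i2)).
  rewrite -ge0_integralD//; last 2 first.
  + by apply: mdist => //; exact: measurable_indic.
  + by apply: mdist => //; exact: measurable_indic.
  apply: le_integral_pointwise => x _; rewrite -EFinD lee_fin /= indicI/=.
  rewrite (_ : _ - _ = \1_A' x * (\1_A x - p1 x) + p1 x * (\1_A' x - p2 x)); last ring.
  apply: (le_trans (ler_normD _ _)); rewrite !normrM lerD// ler_piMl//.
    by rewrite indicE; case: (x \in A'); rewrite ?normr1 ?normr0.
  by have /andP[? ?] := b1 x; rewrite ger0_norm.
Qed.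

(** By continuity of the measure a finite union already carries all but an
arbitrarily small part of the mass. *)
Lemma approximable_bigcup (F : (set E)^nat) :
  (forall k, approximable (F k)) -> approximable (\bigcup_k F k).
Proof.
move=> aF; have mF : measurable (\bigcup_k F k).
  by apply: bigcupT_measurable => k; exact: (aF k).1.
split=> // e e0; have e20 : 0 < e / 2 by rewrite divr_gt0.
pose G N := \big[setU/set0]_(k < N.+1) F k.
have aG N : approximable (G N).
  rewrite /G; elim: N.+1 => [|{}N IH]; first by rewrite big_ord0; exact: approximable0.
  rewrite big_ord_recr /= -[_ `|` _]setCK setCU.
  by apply: approximableC; apply: approximableI; exact: approximableC.
have mG N := (aG N).1.
have GF : \bigcup_N G N = \bigcup_k F k by exact: bigcup_bigsetU_bigcup.
have [N PN] : exists N, (P (\bigcup_k F k `\` G N) <= (e / 2)%:E)%E.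
  have cvgG : P (\bigcup_k F k `\` G N) @[N --> \oo] --> (0 : \bar R).
    rewrite -(measure0 P) (_ : set0 = \bigcap_N (\bigcup_k F k `\` G N)); last first.
      apply/esym; rewrite -subset0 => x FGx; have [Fx _] := FGx 0%N I.
      by move: Fx; rewrite -GF => -[N _ GNx]; have [] := FGx N I.
    apply: nonincreasing_cvg_mu => //.
    - by rewrite (le_lt_trans (probability_le1 P _))// ?ltry//; exact: measurableD.
    - by move=> N; exact: measurableD.
    - by apply: bigcapT_measurable => N; exact: measurableD.
    - move=> i j ij; apply/subsetPset; apply: setDS; exact: subset_bigsetU.
  exact: cvge0_small cvgG e20.
have [p [tp b i]] := (aG N).2 _ e20.
exists p; split => //; rewrite [e]splitr EFinD.
apply: le_trans (leeD PN i).
have mD : measurable (\bigcup_k F k `\` G N) by exact: measurableD.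
have -> : P (\bigcup_k F k `\` G N) =
    (\int[P]_(x in Om) (\1_(\bigcup_k F k `\` G N) x)%:E +
     \int[P]_(x in ~` Om) (\1_(\bigcup_k F k `\` G N) x)%:E)%E.
  rewrite -ge0_integral_setU//.
  - by rewrite setUv integral_indic// setIT.
  - exact: measurableC.
  - by apply: measurable_funTS; apply/measurable_EFinP; exact: measurable_indic.
  - by apply/disj_set2P; rewrite setICr.
apply: (le_trans _ (leeD2r _ (leeDl _ _))); last by apply: integral_ge0 => x _; rewrite lee_fin indicE.
rewrite -ge0_integralD//; last 2 first.
- by apply: measurable_funTS; apply/measurable_EFinP; exact: measurable_indic.
- by apply: mdist => //; exact: measurable_indic.
apply: le_integral_pointwise => x _; rewrite -EFinD lee_fin.
rewrite (_ : \1_(\bigcup_k F k) x - p x =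
  \1_(\bigcup_k F k `\` G N) x + (\1_(G N) x - p x)); last first.
  rewrite addrA; congr (_ - _); rewrite !indicE in_setD.
  have [xG|xG] := boolP (x \in G N); last by rewrite andbT addr0.
  rewrite andbF add0r mem_set//; rewrite -GF; exists N => //; exact: set_mem.
by apply: (le_trans (ler_normD _ _)); rewrite lerD2r ger0_norm.
Qed.

(** The functions [1 - B (k g - 1)] vanish where [g <= 0] and tend to [1] where
[g > 0], as [k] grows. *)
Lemma approximable_pos (g : E -> R) : test_x (L := L) g ->
  approximable [set x | 0 < g x].
Proof.
move=> tg; have mg := test_x_measurable tg.
have mA : measurable [set x | 0 < g x].
  rewrite (_ : [set x | _] = g @^-1` `]0, +oo[%classic).
    by rewrite -[X in measurable X]setTI; exact: mg.
  by apply/seteqP; split => x /=; rewrite in_itv/= andbT.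
split=> // e e0.
pose p k x := 1 - B (k%:R * g x - 1).
have tp k : test_x (L := L) (p k).
  split.
    apply: smoothB; first exact: smooth_cst.
    apply: (@smooth_comp _ _ B (fun x => k%:R * g x - 1)); first exact: step_smooth.
    by apply: smoothB; [apply: smoothZ; exact: tg.1|exact: smooth_cst].
  by move=> j x; rewrite /p tg.2.
have p01 k x : 0 <= p k x <= 1 by have := step_itv hB (k%:R * g x - 1); rewrite /p; lra.
have pcvg x : p k x @[k --> \oo] --> (\1_[set x | 0 < g x] x : R).
  rewrite indicE; case: (boolP (x \in _)); rewrite ?inE/= => gx.
    apply: cvg_near_cst; near=> k; rewrite /p (step_right hB) ?subr0//.
    rewrite lerBrDr -ler_pdivrMr//; near: k; exact: nbhs_infty_ger.
  apply: cvg_near_cst; apply: nearW => k; rewrite /p (step_left hB) ?subrr//.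
  move: gx; rewrite notin_setE/= => /negP; rewrite -leNgt => gx.
  by rewrite gerDr mulr_ge0_le0.
have [|||||_ + _] := @dominated_convergence _ _ _ P Om mOm (fun k x => (p k x)%:E)
  (fun x => (\1_[set x | 0 < g x] x)%:E) (cst 1)%E.
  - by move=> k; apply/measurable_EFinP; apply: measurable_funTS; exact: test_x_measurable.
  - by apply/measurable_EFinP; apply: measurable_funTS; exact: measurable_indic.
  - by apply: aeW => x _; apply/cvg_EFin; [exact: nearW|exact: pcvg].
  - exact: finite_measure_integrable_cst.
  - by apply: aeW => x k _; rewrite /= lee_fin ger0_norm; have := p01 k x; lra.
move=> /cvge0_small - /(_ _ e0)[k ke]; exists (p k); split => //.
apply: le_trans ke; apply: le_integral_pointwise => x _.
by rewrite -EFinB /= lee_fin distrC.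
Unshelve. all: by end_near. Qed.

(** On the cell, [x_i < a] is the union of the arc [0 < x_i < a] and of the face
[x_i = 0], the latter being the complement of the arc [0 < x_i < L]. *)
Lemma approximable_coord (i : 'I_n) (a : R) :
  approximable [set x : E | x ord0 i < a].
Proof.
have mI c : measurable [set x : E | x ord0 i < c].
  rewrite (_ : [set x | _] = (fun x : E => x ord0 i) @^-1` `]-oo, c[%classic).
    by rewrite -[X in measurable X]setTI; exact: measurable_coord.
  by apply/seteqP; split => x /=; rewrite in_itv/=.
pose A c := [set x : E | 0 < arc L c (x ord0 i)].
have tA c : approximable (A c).
  apply: approximable_pos; split.
    by apply: (@smooth_comp _ _ (arc L c) (fun x : E => x ord0 i));
      [exact: smooth_arc|exact: smooth_coord].
  by move=> k x; rewrite !mxE arc_periodic.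
have AE c : 0 < c <= L -> A c `&` Om = [set x : E | 0 < x ord0 i < c] `&` Om.
  by move=> c0L; apply/seteqP; split => x [Ax Ox]; split => //; move: Ax; rewrite /A/= arc_gt0.
have [a0|a0] := leP a 0.
  apply: (@approximable_cell set0) => //; last exact: approximable0.
  rewrite set0I; apply/esym; rewrite -subset0 => x [/= xa /(_ i)/andP[x0 _]].
  by move: xa; rewrite ltNge (le_trans a0).
have [aL|La] := leP a L; last first.
  apply: (@approximable_cell (~` set0)) => //; last exact/approximableC/approximable0.
  rewrite setC0 setTI; apply/esym/setIidr => x /= /(_ i)/andP[_ xL].
  exact: lt_trans La.
apply: (@approximable_cell (~` ((~` (A a)) `&` A L))) => //; last first.
  by apply: approximableC; apply: approximableI => //; exact: approximableC.
apply/seteqP; split => x [Ax Ox]; split => //; have /andP[x0 xL] := Ox i; move: Ax.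
- move=> /= Ax; rewrite ltNge; apply/negP => ax; apply: Ax; split.
    by rewrite /A /= arc_gt0 ?a0 ?aL ?x0// (ltNge _ a) ax andbF.
  by rewrite /A /= arc_gt0 ?L_gt0 ?lexx ?x0// xL andbT (lt_le_trans a0).
- rewrite /= => xa; rewrite /A/= !arc_gt0 ?a0 ?aL ?x0 ?L_gt0 ?lexx// xa xL !andbT.
  by move=> [].
Qed.

(** The approximable sets form a sigma-algebra, and the half-spaces delimited by
the coordinates generate all measurable sets. *)
Lemma approximable_measurable (A : set E) : measurable A -> approximable A.
Proof.
have sigma : sigma_algebra setT approximable.
  split; [exact: approximable0| |exact: approximable_bigcup].
  by move=> A' aA; rewrite setTD; exact: approximableC.
move: A; apply: smallest_sub => // A.
rewrite -bigcup_seq => -[i _ /= [D mD <-]]; rewrite setTI.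
have {mD} : <<s @RGenInftyO.G R >> D.
  have mD' : (@ocitv R).-sigma.-measurable D by exact: mD.
  by rewrite RGenInftyO.measurableE in mD'.
move: D; apply: smallest_sub.
  split => [|D aD|F aF].
  - by rewrite preimage_set0; exact: approximable0.
  - by rewrite setTD preimage_setC; exact: approximableC.
  - by rewrite preimage_bigcup; exact: approximable_bigcup.
move=> _ [a ->]; rewrite (_ : _ @^-1` _ = [set x : E | x ord0 i < a]).
  exact: approximable_coord.
by apply/seteqP; split => x /=; rewrite in_itv.
Qed.

Import HBNNSimple.

Lemma nnsfun_L1_approx (h : {nnsfun E >-> R}) : exists K, L1_approx K h.
Proof.
have [s [s0 ->]] : exists s : seq R, (forall y, y \in s -> 0 <= y) /\
    (h : E -> R) = (fun x => \sum_(y <- s) y * \1_(h @^-1` [set y]) x).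
  exists (finmap.enum_fset (fset_set (range h))); split.
    by move=> y; rewrite in_fset_set// inE => -[x _ <-].
  by apply/funext => x; rewrite [LHS]fimfunE fsbig_finite.
have mh y : measurable (h @^-1` [set y]) by [].
elim: s s0 => [_|y s IH ys].
  exists 0 => e e0; exists (cst 0); split.
  - by split=> //; exact: smooth_cst.
  - by move=> x; rewrite lexx.
  - rewrite integral0_eq; first by rewrite lee_fin ltW.
    by move=> x _; rewrite big_nil subrr normr0.
have [z zs|K aK] := IH; first by apply: ys; rewrite inE zs orbT.
exists (y * 1 + K).
rewrite (_ : (fun _ => _) = ((fun x => y * \1_(h @^-1` [set y]) x) \+
    (fun x => \sum_(y <- s) y * \1_(h @^-1` [set y]) x))); last first.
  by apply/funext => x; rewrite big_cons.
apply: L1_approxD => //.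
- by apply: measurable_funM => //; exact: measurable_indic.
- apply: measurable_sum => z; apply: measurable_funM => //; exact: measurable_indic.
- apply: L1_approxZ; [by apply: ys; rewrite mem_head|exact: measurable_indic|].
  exact: (approximable_measurable (mh y)).2.
Qed.


End test_approximation.

(** * Spatial density and mean velocity *)

Section integral_law_signed.
Local Open Scope ereal_scope.
Context {R : realType} {n : nat} {L : R}.
Local Notation E := 'rV[R]_n.
Local Notation Om := (@cell R n L).
Local Notation leb := (@lebesgue_rV R n).

(** Both sides are differences of the same two nonnegative integrals, possibly
infinite. *)
Lemma integral_law (r : E -> R) (f : E -> \bar R) : is_density L r ->
  measurable_fun setT f ->
  \int[law L r]_x f x = \int[leb]_(x in Om) (f x * (r x)%:E).
Proof.
move=> dr mf; rewrite integralE [RHS]integralE.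
have [_ _ r0 _] := dr.
rewrite !(ge0_integral_law dr)//.
- congr (_ - _); apply: eq_integral => x _.
  + by rewrite !funeposE maxeMl ?lee_fin// mul0e.
  + by rewrite !funenegE -mulNe maxeMl ?lee_fin// mul0e.
- exact: measurable_funeneg.
- exact: measurable_funepos.
Qed.

Lemma measurable_section_integral d1 d2 (T1 : measurableType d1) (T2 : measurableType d2)
    (m2 : {sigma_finite_measure set T2 -> \bar R}) (f : T1 * T2 -> \bar R) :
  measurable_fun setT f -> measurable_fun setT (fun x => \int[m2]_y f (x, y)).
Proof.
move=> mf; under eq_fun do rewrite integralE.
apply: emeasurable_funB.
  rewrite (_ : (fun x => _) = fubini_F m2 f^\+).
    by apply: measurable_fun_fubini_tonelli_F => //; exact: measurable_funepos.
  by apply/funext => x; apply: eq_integral => y _; rewrite !funeposE.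
rewrite (_ : (fun x => _) = fubini_F m2 f^\-).
  by apply: measurable_fun_fubini_tonelli_F => //; exact: measurable_funeneg.
by apply/funext => x; apply: eq_integral => y _; rewrite !funenegE.
Qed.

Lemma ge0_integral_phase (F : E * E -> \bar R) :
  measurable_fun setT F -> (forall z, 0 <= F z) ->
  \int[leb \x leb]_(z in Om `*` setT) F z = \int[leb]_(x in Om) \int[leb]_v F (x, v).
Proof.
move=> mF F0; have mOm := @measurable_cell R n L.
rewrite integral_mkcond fubini_tonelli1.
- rewrite [RHS]integral_mkcond; apply: eq_integral => x _; rewrite /fubini_F patchE.
  case: ifPn => xO; last first.
    rewrite integral0_eq// => v _; rewrite patchE ifF//.
    by apply/negbTE; move: xO; apply: contra; rewrite !inE => -[].
  apply: eq_integral => v _; rewrite patchE ifT//.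
  by move: xO; rewrite !inE.
- apply/(measurable_restrictT _ _).1 => //; first exact: measurableX.
  exact: measurable_funTS.
- by move=> z; apply: erestrict_ge0.
Qed.

Lemma measurable_phase : measurable (Om `*` [set: E]).
Proof. by apply: measurableX => //; exact: measurable_cell. Qed.

End integral_law_signed.
Lemma measurable_inv_ge0 (R : realType) d (T : measurableType d) (f : T -> R) :
  measurable_fun setT f -> (forall x, 0 <= f x) -> measurable_fun setT (fun x => (f x)^-1).
Proof.
move=> mf f0; under eq_fun do rewrite -powR_inv1//.
exact: (measurableT_comp (measurable_powR _)).
Qed.

Section kinetic_density.
Context {R : realType} {n : nat} {L : R}.
Local Notation E := 'rV[R]_n.
Local Notation Om := (@cell R n L).
Local Notation Ph := (@cell R n L `*` [set: E]).
Local Notation leb := (@lebesgue_rV R n).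

(** What a solution satisfies at every single time. *)
Record kinetic_density (h : E -> E -> R) : Prop := KineticDensity {
  kd_measurable : measurable_fun setT (fun z : E * E => h z.1 z.2) ;
  kd_periodic : Defs.periodic L h ;
  kd_ge0 : forall x v, 0 <= h x v ;
  kd_mass : unit_mass (L := L) h
}.

Variable h : E -> E -> R.
Hypothesis hh : kinetic_density h.

Let h0 x v : 0 <= h x v := kd_ge0 hh x v.
Let mh : measurable_fun setT (fun z : E * E => (h z.1 z.2)%:E).
Proof. by apply/measurable_EFinP; exact: kd_measurable hh. Qed.
Let mOm : measurable Om := @measurable_cell R n L.

Lemma measurable_velocity_slice x : measurable_fun setT (h x).
Proof.
have -> : h x = (fun z : E * E => h z.1 z.2) \o pair x by [].
by apply: measurableT_comp => //; exact: kd_measurable.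
Qed.

Lemma measurable_marginal : measurable_fun setT (fun x => \int[leb]_v (h x v)%:E)%E.
Proof. exact: (measurable_section_integral leb mh). Qed.

Lemma marginal_mass : (\int[leb]_(x in Om) \int[leb]_v (h x v)%:E = 1)%E.
Proof.
rewrite -(ge0_integral_phase mh) => [|z]; last by rewrite lee_fin.
exact: kd_mass hh.
Qed.

(** [rho h x] is the real number attached to an extended integral, and is [0]
where the latter is infinite; finite total mass makes this exceptional. *)
Lemma marginal_ae :
  {ae leb, forall x, Om x -> (\int[leb]_v (h x v)%:E = (rho h x)%:E)%E}.
Proof.
have i1 : leb.-integrable Om (fun x => \int[leb]_v (h x v)%:E)%E.
  apply/integrableP; split; first by apply: measurable_funTS; exact: measurable_marginal.
  rewrite (eq_integral (fun x => \int[leb]_v (h x v)%:E)%E) ?marginal_mass ?ltry//.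
  by move=> x _; rewrite gee0_abs//; apply: integral_ge0 => v _; rewrite lee_fin.
have := integrable_ae mOm i1; apply: filterS => x fx Ox.
by rewrite /rho /Rintegral fineK//; exact: fx.
Qed.

Lemma rho_ge0 x : 0 <= rho h x.
Proof. by apply: Rintegral_ge0 => v _. Qed.

Lemma measurable_rho : measurable_fun setT (rho h).
Proof. by apply: measurableT_comp => //; exact: measurable_marginal. Qed.

Lemma integral_rho (g : E -> \bar R) : measurable_fun setT g -> (forall x, 0 <= g x)%E ->
  (\int[leb]_(x in Om) (g x * (rho h x)%:E) =
   \int[leb \x leb]_(z in Ph) (g z.1 * (h z.1 z.2)%:E))%E.
Proof.
move=> mg g0; rewrite ge0_integral_phase; last 2 first.
- apply: emeasurable_funM => //; exact: measurableT_comp.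
- by move=> z; rewrite mule_ge0 ?lee_fin.
apply: ae_eq_integral => //.
- apply: measurable_funTS; apply: emeasurable_funM => //.
  by apply/measurable_EFinP; exact: measurable_rho.
- apply: measurable_funTS.
  apply: (@measurable_section_integral _ _ _ _ _ leb (fun z => g z.1 * (h z.1 z.2)%:E)%E).
  apply: emeasurable_funM => //; exact: measurableT_comp.
- apply: filterS marginal_ae => x hx Ox; rewrite -hx//.
  rewrite -ge0_integralZl//= => [|v _]; last by rewrite lee_fin.
  by apply/measurable_EFinP; exact: measurable_velocity_slice.
Qed.

Lemma rho_density : is_density L (rho h).
Proof.
split; first exact: measurable_rho.
- by move=> k x; rewrite /rho; under eq_Rintegral do rewrite (kd_periodic hh).
- exact: rho_ge0.
- rewrite -marginal_mass; apply: ae_eq_integral => //.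
  + by apply: measurable_funTS; apply/measurable_EFinP; exact: measurable_rho.
  + by apply: measurable_funTS; exact: measurable_marginal.
  + by apply: filterS marginal_ae => x hx Ox; rewrite hx.
Qed.

Lemma measurable_mean_velocity i : measurable_fun setT (fun x => mean_velocity h x ord0 i).
Proof.
under eq_fun do rewrite !mxE.
apply: measurable_funM; first by apply: measurable_inv_ge0; [exact: measurable_rho|exact: rho_ge0].
apply: measurableT_comp => //.
apply: (@measurable_section_integral _ _ _ _ _ leb (fun z => (z.2 ord0 i * h z.1 z.2)%:E)).
apply/measurable_EFinP; apply: measurable_funM; last exact: kd_measurable.
by apply: (measurableT_comp (measurable_coord i)).
Qed.

(** The Cauchy-Schwarz inequality for the measure [h x v dv], in the form of the
integral of [2 a v_i - a^2 <= v_i^2] with [a] the mean of [v_i]. *)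
Lemma mean_velocity_sqr_le i :
  {ae leb, forall x, Om x -> ((mean_velocity h x ord0 i ^+ 2 * rho h x)%:E <=
    \int[leb]_v (v ord0 i ^+ 2 * h x v)%:E)%E}.
Proof.
apply: filterS marginal_ae => x hx Ox.
have mhx := measurable_velocity_slice x.
have mi := @measurable_coord R n i.
set V := (\int[leb]_v _)%E.
have V0 : (0 <= V)%E by apply: integral_ge0 => v _; rewrite lee_fin mulr_ge0// sqr_ge0.
have [Vy|] := ltP V +oo%E; last by rewrite leye_eq => /eqP ->; rewrite leey.
have ih : leb.-integrable setT (EFin \o h x).
  apply/integrableP; split; first exact/measurable_EFinP.
  rewrite (eq_integral (fun v => (h x v)%:E)) ?hx ?ltry// => v _.
  by rewrite /= ger0_norm.
have iV : leb.-integrable setT (EFin \o (fun v : E => v ord0 i ^+ 2 * h x v)).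
  apply/integrableP; split.
    by apply/measurable_EFinP; apply: measurable_funM => //; exact: measurable_funX.
  apply: le_lt_trans Vy; apply: le_integral_pointwise => v _.
  by rewrite /= ger0_norm// mulr_ge0// sqr_ge0.
have im : leb.-integrable setT (EFin \o (fun v : E => v ord0 i * h x v)).
  apply: le_integrable (integrableD _ ih iV) => //.
    by apply/measurable_EFinP; exact: measurable_funM.
  move=> v _; rewrite /= lee_fin normrM (ger0_norm (h0 _ _)).
  rewrite [leRHS]ger0_norm; last by apply: addr_ge0 => //; apply: mulr_ge0 => //; exact: sqr_ge0.
  apply: (@le_trans _ _ ((1 + v ord0 i ^+ 2) * h x v)); last first.
    by rewrite mulrDl mul1r.
  rewrite ler_wpM2r//.
  by have := sqr_ge0 (`|v ord0 i| - 1); rewrite -(real_normK (num_real (v ord0 i))); nra.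
set a := mean_velocity h x ord0 i.
have rhoE : \int[leb]_v h x v = rho h x by [].
have aE : a * rho h x = \int[leb]_v (v ord0 i * h x v).
  have [r0|rN0] := eqVneq (rho h x) 0; last by rewrite /a !mxE mulrAC mulVf// mul1r.
  (* the mean velocity is [0] by convention where the density vanishes; the
     momentum vanishes there as well *)
  rewrite r0 mulr0; apply/esym/eqP; rewrite -normr_le0.
  have mhE : measurable_fun setT (fun v => (h x v)%:E) by exact/measurable_EFinP.
  have hz : ae_eq leb setT (fun v => (h x v)%:E) (cst 0%E).
    apply: (ae_eq_integral_abs leb measurableT mhE).1.
    by under eq_integral do rewrite gee0_abs ?lee_fin//; rewrite hx// r0.
  rewrite (_ : Rintegral _ _ _ = 0) ?normr0//.
  rewrite /Rintegral (ae_eq_integral (cst 0%E)) ?integral0//.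
  + by apply/measurable_EFinP; exact: measurable_funM.
  + by apply: filterS hz => w hw _; rewrite /= EFinM (hw I) mule0.
have -> : V = (\int[leb]_v (v ord0 i ^+ 2 * h x v))%:E.
  by rewrite /Rintegral fineK// ge0_fin_numE.
rewrite lee_fin.
have : \int[leb]_v (2 * a * (v ord0 i * h x v) - a ^+ 2 * h x v) <=
       \int[leb]_v (v ord0 i ^+ 2 * h x v).
  apply: le_Rintegral => //.
    have := integrableB measurableT (integrableZl measurableT (2 * a) im)
      (integrableZl measurableT (a ^+ 2) ih).
    exact.
  by move=> v _; rewrite mulrA -mulrBl ler_wpM2r//; have := sqr_ge0 (v ord0 i - a); nra.
rewrite RintegralB//; last 2 first.
- exact: (integrableZl measurableT (2 * a) im).
- exact: (integrableZl measurableT (a ^+ 2) ih).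
rewrite !RintegralZl// -aE rhoE; apply: le_trans.
by rewrite le_eqVlt; apply/orP; left; apply/eqP; ring.
Qed.

End kinetic_density.

(** * The dissipation is nonnegative *)

Lemma Lfun2_sqr d (T : measurableType d) (R : realType) (mu : {measure set T -> \bar R})
    (f : T -> R) : measurable_fun setT f -> (\int[mu]_x (f x ^+ 2)%:E < +oo)%E ->
  f \in Lfun mu 2%:E.
Proof.
move=> mf f2; rewrite inE; apply/andP; split; rewrite inE//= /finite_norm unlock.
apply: poweR_lty; apply: le_lt_trans f2; apply: le_integral_pointwise => x _.
by rewrite /= lee_fin powR_mulrn// real_normK// num_real.
Qed.

Lemma Lfun_measurable d (T : measurableType d) (R : realType) (mu : {measure set T -> \bar R})
    (f : T -> R) p : f \in Lfun mu p -> measurable_fun setT f.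
Proof. by rewrite inE => /andP[]; rewrite inE. Qed.

Section averaging.
Context {R : realType} {n : nat} {L : R} (M : averaging_model R n L).
Local Notation E := 'rV[R]_n.
Variables (P : probability E R) (PL : on_torus L P) (S : R).
Local Notation s := (em_s M P).
Local Notation phi := (em_phi M P).
Hypothesis sS : forall x, s x <= S.
Hypothesis cons : {ae P, forall y, (\int[P]_x (phi x y)%:E = (s y)%:E)%E}.

Let s0 x : 0 <= s x := em_s_ge0 M PL x.
Let ms : measurable_fun setT s.
Proof. by apply: continuous_measurable_rV; exact: em_s_continuous. Qed.
Let mphi : measurable_fun setT (fun z : E * E => (phi z.1 z.2)%:E).
Proof. exact: measurable_int (em_phi_integrable M PL). Qed.
Let phi0 x y : 0 <= phi x y := em_phi_ge0 M PL x y.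

Lemma weighted_integrable (f : E -> R) : P.-integrable setT (EFin \o f) ->
  P.-integrable setT (EFin \o (fun x => s x * f x)).
Proof.
move=> iF.
have mf : measurable_fun setT f by apply/measurable_EFinP; exact: measurable_int iF.
apply: le_integrable (integrableZl measurableT S iF) => //.
  by apply/measurable_EFinP; exact: measurable_funM.
move=> x _; rewrite /= lee_fin !normrM ler_wpM2r//.
by rewrite ger0_norm// (le_trans (sS x))// ler_norm.
Qed.

(** Expand [s [w]] with the kernel and use [w(x) w(y) <= (w(x)^2 + w(y)^2) / 2].
In the first square the kernel is integrated in [y], in the second one in [x];
conservativity says that the weight is [s] in both cases. *)
Lemma averaging_contraction (w : E -> R) : w \in Lfun P 2%:E ->
  [/\ P.-integrable setT (EFin \o (fun x => s x * (w x * em_avg M P w x))),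
      P.-integrable setT (EFin \o (fun x => s x * w x ^+ 2)) &
      (\int[P]_x (s x * (w x * em_avg M P w x))%:E <= \int[P]_x (s x * w x ^+ 2)%:E)%E].
Proof.
move=> w2; have mw := Lfun_measurable w2.
have [avg2 _] := em_avg_bounded M PL (or_introl erefl).
have aw2 := avg2 _ w2.
have i1 : P.-integrable setT (EFin \o (fun x => s x * (w x * em_avg M P w x))).
  apply: weighted_integrable; apply/Lfun1_integrable; exact: Lfun2_mul_Lfun1.
have i2 : P.-integrable setT (EFin \o (fun x => s x * w x ^+ 2)).
  by apply: weighted_integrable; exact: Lfun2_integrable_sqr.
split=> //.
pose Phi x := (\int[P]_y (phi x y * w y ^+ 2)%:E)%E.
have mphiw : measurable_fun setT (fun z : E * E => (phi z.1 z.2 * w z.2 ^+ 2)%:E).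
  apply/measurable_EFinP; apply: measurable_funM; first exact/measurable_EFinP.
  by apply: measurable_funX; apply: (measurableT_comp mw).
have Phi0 x : (0 <= Phi x)%E.
  by apply: integral_ge0 => y _; rewrite lee_fin mulr_ge0// sqr_ge0.
have mPhi : measurable_fun setT Phi by exact: (measurable_section_integral P mphiw).
have mphi1 x : measurable_fun setT (phi x).
  apply/measurable_EFinP; rewrite (_ : EFin \o _ = (fun z : E * E => (phi z.1 z.2)%:E) \o pair x)//.
  exact: measurableT_comp.
have mphi2 y : measurable_fun setT (phi ^~ y).
  apply/measurable_EFinP; rewrite (_ : EFin \o _ = (fun z : E * E => (phi z.1 z.2)%:E) \o (pair^~ y))//.
  exact: measurableT_comp.
have PhiE : (\int[P]_x Phi x <= \int[P]_y (s y * w y ^+ 2)%:E)%E.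
  have -> : (\int[P]_x Phi x = \int[P]_y \int[P]_x (phi x y * w y ^+ 2)%:E)%E.
    by apply: (@fubini_tonelli _ _ _ _ _ P P _ mphiw) => z; rewrite lee_fin mulr_ge0// sqr_ge0.
  apply: le_integral_ae; apply: filterS cons => y cy _.
  under eq_integral do rewrite mulrC EFinM.
  rewrite ge0_integralZl//=.
  - by rewrite cy -EFinM mulrC.
  - exact/measurable_EFinP.
  - by move=> x _; rewrite lee_fin.
  - by rewrite lee_fin sqr_ge0.
have ptw : {ae P, forall x, setT x -> ((s x * (w x * em_avg M P w x))%:E <=
    (2^-1)%:E * ((s x * w x ^+ 2)%:E + Phi x))%E}.
  apply: filterS2 (em_phi_s M PL) (em_phi_avg M PL w2) => x sx avgx _.
  (* only where the second moment of the kernel is finite can the product be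
     moved under the integral sign *)
  have [Py|] := ltP (Phi x) +oo%E; last first.
    by rewrite leye_eq => /eqP ->; rewrite addey// mulry gtr0_sg ?mul1e ?leey.
  have iphi : P.-integrable setT (EFin \o phi x).
    apply/integrableP; split; first exact/measurable_EFinP.
    apply: (@le_lt_trans _ _ (\int[P]_y (phi x y)%:E)%E); last by rewrite sx ltry.
    by apply: le_integral_pointwise => y _; rewrite /= ger0_norm.
  have iphi2 : P.-integrable setT (EFin \o (fun y => phi x y * w y ^+ 2)).
    apply/integrableP; split.
      by apply/measurable_EFinP; apply: measurable_funM => //; exact: measurable_funX.
    apply: le_lt_trans Py; apply: le_integral_pointwise => y _.
    by rewrite /= ger0_norm// mulr_ge0// sqr_ge0.
  have iphiw : P.-integrable setT (EFin \o (fun y => phi x y * w y)).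
    apply: le_integrable (integrableD _ iphi iphi2) => //.
      by apply/measurable_EFinP; exact: measurable_funM.
    move=> y _; rewrite /= lee_fin normrM (ger0_norm (phi0 _ _)).
    rewrite [leRHS]ger0_norm; last by apply: addr_ge0 => //; apply: mulr_ge0 => //; exact: sqr_ge0.
    apply: (@le_trans _ _ (phi x y * (1 + w y ^+ 2))); last by rewrite mulrDr mulr1.
    rewrite ler_wpM2l//.
    by have := sqr_ge0 (`|w y| - 1); rewrite -(real_normK (num_real (w y))); nra.
  rewrite mulrCA EFinM avgx -integralZl//.
  have -> : (s x * w x ^+ 2)%:E = (\int[P]_y (phi x y * w x ^+ 2)%:E)%E.
    rewrite EFinM -sx muleC -integralZl//.
    by apply: eq_integral => y _; rewrite -EFinM mulrC.
  have mphiwx : measurable_fun setT (fun y => (phi x y * w x ^+ 2)%:E).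
    by apply/measurable_EFinP; apply: measurable_funM.
  have mphiwy : measurable_fun setT (fun y => (phi x y * w y ^+ 2)%:E).
    by apply/measurable_EFinP; apply: measurable_funM => //; exact: measurable_funX.
  rewrite -ge0_integralD//; last 2 first.
  - by move=> y _; rewrite lee_fin mulr_ge0// sqr_ge0.
  - by move=> y _; rewrite lee_fin mulr_ge0// sqr_ge0.
  rewrite -ge0_integralZl//; last 2 first.
  - exact: emeasurable_funD.
  - by move=> y _; rewrite -EFinD lee_fin addr_ge0// mulr_ge0// sqr_ge0.
  apply: le_integral_pointwise => y _; rewrite -EFinD -!EFinM lee_fin.
  rewrite -mulrDr mulrCA [leRHS]mulrCA ler_wpM2l//.
  by have := sqr_ge0 (w x - w y); nra.
have i2y : (\int[P]_x (s x * w x ^+ 2)%:E < +oo)%E.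
  apply: le_lt_trans (integrableP _ _ _ i2).2; apply: le_integral_pointwise => x _.
  by rewrite /= ger0_norm// mulr_ge0// sqr_ge0.
have i20 : (0 <= \int[P]_x (s x * w x ^+ 2)%:E)%E.
  by apply: integral_ge0 => x _; rewrite lee_fin mulr_ge0// sqr_ge0.
have ms2 : measurable_fun setT (fun x => (s x * w x ^+ 2)%:E) := measurable_int _ i2.
apply: le_trans (le_integral_ae ptw) _.
rewrite ge0_integralZl//; last 2 first.
- exact: emeasurable_funD.
- by move=> x _; rewrite adde_ge0// lee_fin mulr_ge0// sqr_ge0.
rewrite ge0_integralD//; last by move=> x _; rewrite lee_fin mulr_ge0// sqr_ge0.
apply: (@le_trans _ _ ((2^-1)%:E * (\int[P]_x (s x * w x ^+ 2)%:E + \int[P]_x (s x * w x ^+ 2)%:E))%E).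
  by rewrite lee_wpmul2l ?lee_fin// leeD2l.
rewrite -(fineK (x := \int[P]_x _)%E); last by rewrite ge0_fin_numE.
by rewrite -EFinD -EFinM lee_fin; lra.
Qed.


End averaging.

Section dissipation.
Context {R : realType} {n : nat} {L : R} (M : averaging_model R n L) (pr : params R n).
Local Notation E := 'rV[R]_n.
Local Notation Om := (@cell R n L).
Local Notation Ph := (@cell R n L `*` [set: E]).
Local Notation leb := (@lebesgue_rV R n).
Variable h : E -> E -> R.
Hypothesis hh : kinetic_density (L := L) h.

Let dr : is_density L (rho h) := rho_density hh.
Let PL : on_torus L (law_of (L := L) h) := on_torus_law dr.

(** The averages act on [L^2(rho dx)], and the second moment of [h] in [v]
controls the norm of the mean velocity there. *)
Lemma mean_velocity_Lfun2 i :
  (\int[leb \x leb]_(z in Ph) (dot z.2 z.2 * h z.1 z.2)%:E < +oo)%E ->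
  (fun x => mean_velocity h x ord0 i) \in Lfun (law_of (L := L) h) 2%:E.
Proof.
move=> mom; apply: Lfun2_sqr; first exact: (measurable_mean_velocity hh).
have mw2 : measurable_fun setT (fun x => (mean_velocity h x ord0 i ^+ 2)%:E).
  by apply/measurable_EFinP; apply: measurable_funX; exact: (measurable_mean_velocity hh).
rewrite integral_law//; apply: le_lt_trans mom.
apply: (le_trans (le_integral_ae (mean_velocity_sqr_le hh i))).
rewrite -(ge0_integral_phase (F := fun z => (z.2 ord0 i ^+ 2 * h z.1 z.2)%:E)).
- apply: le_integral_pointwise => z _; rewrite lee_fin ler_wpM2r//; first exact: (kd_ge0 hh).
  rewrite /dot (bigD1 i)//= -expr2 lerDl; apply: sumr_ge0 => j _.
  by rewrite -expr2 sqr_ge0.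
- apply/measurable_EFinP; apply: measurable_funM; last exact: (kd_measurable hh).
  by apply: measurable_funX; apply: (measurableT_comp (measurable_coord i)).
- by move=> z; rewrite lee_fin mulr_ge0// ?sqr_ge0//; exact: (kd_ge0 hh).
Qed.

Lemma kappa_dotE (a b : E -> E) :
  (forall i, (law_of (L := L) h).-integrable setT (EFin \o
     (fun x => strength M h x * (a x ord0 i * b x ord0 i)))) ->
  kappa_dot M h a b =
  \sum_(i < n) \int[law_of (L := L) h]_x (strength M h x * (a x ord0 i * b x ord0 i)).
Proof.
move=> iab; rewrite /kappa_dot /Rintegral.
under eq_integral => x _.
  rewrite [_ * strength _ _ _]mulrC mulrA [_ * strength _ _ _]mulrC EFinM /dot mulr_sumr.
  rewrite -sumEFin; over.
rewrite -(integral_law (f := fun x => (\sum_(i < n)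
    (strength M h x * (a x ord0 i * b x ord0 i))%:E)%E) dr); last first.
  by apply: emeasurable_sum => i; exact: measurable_int (iab i).
rewrite integral_sum// -sum_fine// => i _; exact: integrable_fin_num (iab i).
Qed.

Lemma fisher_ge0 (s : E -> R) G g : (forall x, 0 <= s x) -> 0 <= fisher (L := L) pr s h G g.
Proof.
move=> s0; apply: Rintegral_ge0 => z _ /=.
by rewrite mulr_ge0// divr_ge0 ?dot_ge0//; exact: (kd_ge0 hh).
Qed.

(** Finiteness of the second moment is essential: the integrals in the
dissipation are real numbers, equal to [0] when they diverge, so that the
comparison of the two alignment terms is meaningless otherwise. *)
Lemma dissipation_ge0 G w H : regular M -> conservative M ->
  (\int[leb \x leb]_(z in Ph) (dot z.2 z.2 * h z.1 z.2)%:E < +oo)%E ->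
  0 <= dissipation M pr h G w H.
Proof.
move=> [[S sS] _ _ _ _] cons mom.
have str0 x : 0 <= strength M h x by exact: em_s_ge0.
have strS x : em_s M (law_of (L := L) h) x <= S.
  rewrite -lee_fin (le_trans _ (sS _ PL))// /sup_norm.
  by apply: ereal_sup_ubound; exists x => //=; rewrite ger0_norm//; exact: str0.
have ac i := averaging_contraction PL strS (cons _ PL) (mean_velocity_Lfun2 i mom).
have kle : kappa_dot M h (mean_velocity h) (avg_velocity M h) <=
    kappa_dot M h (mean_velocity h) (mean_velocity h).
  have ac1 i : (law_of (L := L) h).-integrable setT (EFin \o
      (fun x => strength M h x * (mean_velocity h x ord0 i * avg_velocity M h x ord0 i))).
    by have [+ _ _] := ac i; apply: eq_integrable => // x _; rewrite /= !mxE.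
  have ac2 i : (law_of (L := L) h).-integrable setT (EFin \o
      (fun x => strength M h x * (mean_velocity h x ord0 i * mean_velocity h x ord0 i))).
    by have [_ + _] := ac i; apply: eq_integrable => // x _; rewrite /= expr2.
  rewrite !kappa_dotE//; apply: ler_sum => i _; apply: fine_le.
  - exact: integrable_fin_num (ac1 i).
  - exact: integrable_fin_num (ac2 i).
  - have [_ _ aci] := ac i; apply: (le_trans _ (le_trans aci _)).
      by apply: le_integral_pointwise => x _; rewrite lee_fin /avg_velocity /avg_vec mxE.
    by apply: le_integral_pointwise => x _; rewrite lee_fin expr2.
have [[[ag bg] gg] ng] := (alpha_gt0 pr, beta_gt0 pr, gamma_gt0 pr, nu_gt0 pr).
rewrite /dissipation; apply: addr_ge0.
- rewrite -addrA -mulrBr addr_ge0//; last by rewrite mulr_ge0 ?subr_ge0// ltW.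
  by rewrite addr_ge0// mulr_ge0 ?(ltW ag) ?(ltW bg)// fisher_ge0.
- apply: mulr_ge0; first by apply: divr_ge0; [apply: mulr_ge0|]; exact: ltW.
  by apply: Rintegral_ge0 => x _; apply: sumr_ge0 => i _; exact: dot_ge0.
Qed.

End dissipation.

(** * Duality for the relative entropy *)

Section gaussian.
Context {R : realType}.

(** Tonelli, by induction on the dimension. *)
Lemma integral_prod_rV n (g : R -> R) : measurable_fun setT g -> (forall s, 0 <= g s) ->
  (\int[lebesgue_rV n]_v (\prod_(i < n) g (v ord0 i))%:E =
   (\int[lebesgue_measure]_s (g s)%:E) ^+ n)%E.
Proof.
move=> mg g0.
have mprod m : measurable_fun setT (fun v : 'rV[R]_m => \prod_(i < m) g (v ord0 i)).
  by apply: measurable_prod => i _; apply: (measurableT_comp mg); exact: measurable_coord.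
elim: n => [|n IH].
  rewrite /= integral_dirac//; last by apply/measurable_EFinP; exact: mprod.
  by rewrite diracT mul1e big_ord0.
transitivity (\int[(@lebesgue_measure R \x lebesgue_rV n)%E]_z
   (\prod_(i < n.+1) g (consr z ord0 i))%:E)%E.
  rewrite [LHS](ge0_integral_pushforward (@measurable_consr R n))//.
  - by apply: measurable_funTS; apply/measurable_EFinP; exact: mprod.
  - by move=> v _; rewrite lee_fin prodr_ge0.
rewrite (_ : (fun z => _) = (fun z : R * 'rV[R]_n =>
    (g z.1 * \prod_(i < n) g (z.2 ord0 i))%:E)); last first.
  apply/funext => z; rewrite big_ord_recl mxE unlift_none; congr (_ * _)%:E.
  by apply: eq_bigr => i _; rewrite mxE liftK.
have mgp : measurable_fun setT (fun z : R * 'rV[R]_n =>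
    (g z.1 * \prod_(i < n) g (z.2 ord0 i))%:E).
  apply/measurable_EFinP; apply: measurable_funM.
    exact: (measurableT_comp mg measurable_fst).
  exact: (measurableT_comp (mprod n) measurable_snd).
transitivity (\int[lebesgue_measure]_s \int[lebesgue_rV n]_v
    (g s * \prod_(i < n) g (v ord0 i))%:E)%E.
  apply: (fubini_tonelli1 (m1 := lebesgue_measure) (m2 := lebesgue_rV n) _ mgp) => z.
  by rewrite lee_fin mulr_ge0// prodr_ge0.
rewrite expeS -IH.
under eq_integral => s _.
  under eq_integral do rewrite EFinM.
  rewrite ge0_integralZl//=; [over|by apply/measurable_EFinP; exact: mprod|
    by move=> v _; rewrite lee_fin prodr_ge0|by rewrite lee_fin].
rewrite /= ge0_integralZr//.
- exact/measurable_EFinP.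
- by move=> s _; rewrite lee_fin.
- by apply: integral_ge0 => v _; rewrite lee_fin prodr_ge0.
Qed.

Lemma gaussian_integrable n (s : R) : 0 < s ->
  (\int[lebesgue_rV n]_v (expR (- (dot v v / (2 * s))))%:E < +oo)%E.
Proof.
move=> s0; pose g x := expR (- (x ^+ 2 / (2 * s))).
have mg : measurable_fun setT g.
  apply: measurableT_comp => //; apply: measurableT_comp => //.
  by apply: measurable_funM => //; exact: measurable_funX.
have -> : (fun v : 'rV[R]_n => (expR (- (dot v v / (2 * s))))%:E) =
    (fun v => (\prod_(i < n) g (v ord0 i))%:E).
  apply/funext => v; congr (_%:E); rewrite /dot mulr_suml -sumrN expR_sum.
  by apply: eq_bigr => i _; rewrite /g expr2.
rewrite integral_prod_rV// => [|x]; last exact: expR_ge0.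
have g0 : (0 <= \int[lebesgue_measure]_x (g x)%:E)%E.
  by apply: integral_ge0 => x _; rewrite lee_fin expR_ge0.
suff gy : (\int[lebesgue_measure]_x (g x)%:E < +oo)%E.
  by rewrite -(fineK (x := \int[_]_x _)%E) ?ge0_fin_numE// -EFin_expe ltry.
have sq0 : Num.sqrt s != 0 by rewrite gt_eqF// sqrtr_gt0.
have := @integral_normal_pdf R 0 (Num.sqrt s).
under eq_integral => x _.
  rewrite normal_pdfE// EFinM (_ : normal_fun _ _ _ = g x); last first.
    by rewrite /normal_fun /g subr0 sqr_sqrtr ?ltW// -mulr_natl mulNr.
  over.
rewrite ge0_integralZl//=.
- move=> h; rewrite ltNge leye_eq; apply/negP => /eqP gy; move: h.
  by rewrite gy mulry gtr0_sg ?normal_peak_gt0// mul1e.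
- exact/measurable_EFinP.
- by move=> x _; rewrite lee_fin expR_ge0.
- by rewrite lee_fin normal_peak_ge0.
Qed.

End gaussian.

(** The Legendre inequality between [a ln a] and the exponential, relative to
the weight [m].  It is [ln x <= x - 1] at [x = m e^y / a]. *)
Lemma dual_entropy_pointwise (R : realType) (a m y : R) : 0 <= a -> 0 < m ->
  a * (y + 1) <= a * ln (a / m) + m * expR y.
Proof.
rewrite le_eqVlt => /predU1P[<-|a0] m0; first by rewrite !mul0r add0r mulr_ge0 ?expR_ge0// ltW.
have x0 : 0 < m * expR y / a by rewrite divr_gt0// mulr_gt0 ?expR_gt0.
have : ln (m * expR y / a) <= m * expR y / a - 1.
  have := @le_ln1Dx R (m * expR y / a - 1).
  by rewrite [1 + _]addrC subrK; apply; rewrite ltrBDl subrr.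
rewrite !ln_div ?posrE ?mulr_gt0 ?expR_gt0// lnM ?posrE ?expR_gt0// expRK.
move=> h; rewrite -(ler_pM2l a0) in h.
have aV : a * (m * expR y / a - 1) = m * expR y - a.
  by rewrite mulrBr mulr1 mulrC divfK// gt_eqF.
by rewrite aV in h; lra.
Qed.

Section free_energy.
Context {R : realType} {n : nat} {L : R} (L_gt0 : 0 < L) (pr : params R n).
Local Notation E := 'rV[R]_n.
Local Notation Om := (@cell R n L).
Local Notation Ph := (@cell R n L `*` [set: E]).
Local Notation leb := (@lebesgue_rV R n).
Local Notation leb2 := (@lebesgue_rV R n \x @lebesgue_rV R n)%E.
Local Notation mu := (maxwellian (L := L) pr).

Let Z : R := vol (n := n) L * (2 * pi * sigma pr) `^ (n%:R / 2).

Let Z_gt0 : 0 < Z.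
Proof.
by rewrite mulr_gt0 ?vol_gt0// powR_gt0// !mulr_gt0// ?pi_gt0// sigma_gt0.
Qed.

Lemma maxwellian_gt0 v : 0 < mu v.
Proof. by rewrite mulr_gt0 ?invr_gt0 ?expR_gt0. Qed.

#[local] Hint Resolve maxwellian_gt0 : core.

Lemma measurable_dot : measurable_fun setT (fun v : E => dot v v).
Proof.
by apply: measurable_sum => i; apply: measurable_funM; exact: measurable_coord.
Qed.

Lemma measurable_maxwellian : measurable_fun setT mu.
Proof.
apply: measurable_funM => //; apply: measurableT_comp => //.
by apply: measurableT_comp => //; apply: measurable_funM => //; exact: measurable_dot.
Qed.

Definition maxwellian_mass : R := fine (\int[leb]_v (mu v)%:E).

Lemma maxwellian_massE : (\int[leb]_v (mu v)%:E = maxwellian_mass%:E)%E.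
Proof.
rewrite /maxwellian_mass fineK// ge0_fin_numE; last first.
  by apply: integral_ge0 => v _; rewrite lee_fin ltW.
under eq_integral do rewrite EFinM.
rewrite ge0_integralZl//=.
- apply: lte_mul_pinfty => //; first by rewrite lee_fin invr_ge0 ltW.
  by apply: gaussian_integrable; exact: sigma_gt0.
- apply/measurable_EFinP; apply: measurableT_comp => //.
  by apply: measurableT_comp => //; apply: measurable_funM => //; exact: measurable_dot.
- by rewrite lee_fin invr_ge0 ltW.
Qed.

Lemma maxwellian_mass_ge0 : 0 <= maxwellian_mass.
Proof. by rewrite -lee_fin -maxwellian_massE; apply: integral_ge0 => v _; rewrite lee_fin ltW. Qed.

Lemma integral_maxwellian (g : E -> R) : measurable_fun setT g -> (forall x, 0 <= g x) ->
  (\int[leb2]_(z in Ph) (mu z.2 * g z.1)%:E =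
   maxwellian_mass%:E * \int[leb]_(x in Om) (g x)%:E)%E.
Proof.
move=> mg g0.
have mmu : measurable_fun setT (fun v => (mu v)%:E).
  by apply/measurable_EFinP; exact: measurable_maxwellian.
rewrite ge0_integral_phase; last 2 first.
- apply/measurable_EFinP; apply: measurable_funM.
    exact: (measurableT_comp measurable_maxwellian).
  exact: (measurableT_comp mg).
- by move=> z; rewrite lee_fin mulr_ge0// ltW.
transitivity (\int[leb]_(x in Om) (maxwellian_mass%:E * (g x)%:E))%E.
  apply: eq_integral => x _; rewrite -maxwellian_massE -ge0_integralZr//=.
  - by move=> v _; rewrite lee_fin ltW.
  - by rewrite lee_fin.
rewrite ge0_integralZl//.
- exact: measurable_cell.
- by apply: measurable_funTS; exact/measurable_EFinP.
- by move=> x _; rewrite lee_fin.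
- by rewrite lee_fin maxwellian_mass_ge0.
Qed.

Lemma integral_maxwellian_cst (c : R) : 0 <= c ->
  (\int[leb2]_(z in Ph) (mu z.2 * c)%:E = (maxwellian_mass * (c * L ^+ n))%:E)%E.
Proof.
move=> c0; rewrite (integral_maxwellian (g := cst c))//= EFinM; congr (_ * _)%E.
rewrite EFinM -(lebesgue_cell L_gt0).
exact: (integral_cst leb (@measurable_cell R n L) c%:E).
Qed.

Variable h : E -> E -> R.
Hypothesis hh : kinetic_density (L := L) h.
Local Notation F := (fun z : E * E => h z.1 z.2 * ln (h z.1 z.2 / mu z.2)).

Let h0 x v : 0 <= h x v := kd_ge0 hh x v.
Let mh : measurable_fun setT (fun z : E * E => h z.1 z.2) := kd_measurable hh.
Let mmu2 : measurable_fun setT (fun z : E * E => mu z.2).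
Proof. exact: (measurableT_comp measurable_maxwellian measurable_snd). Qed.
Let mPh : measurable Ph := measurable_phase.

Let mF : measurable_fun setT F.
Proof.
apply: measurable_funM => //; apply: measurableT_comp => //.
by apply: measurable_funM => //; apply: measurable_inv_ge0 => // z; exact: ltW.
Qed.

Lemma moment_le_norm_Lq q : 2 <= q ->
  (\int[leb2]_(z in Ph) ((1 + dot z.2 z.2) * h z.1 z.2)%:E <= norm_Lq (L := L) q h)%E.
Proof.
move=> q2; apply: le_integral_pointwise => z _; rewrite lee_fin (ger0_norm (h0 _ _)).
rewrite ler_wpM2r//; have d1 : 1 <= 1 + dot z.2 z.2 by rewrite lerDl dot_ge0.
rewrite -[leLHS]powRr1 ?(le_trans _ d1)//; apply: ler_powR => //.
by rewrite ler_pdivlMr// mul1r.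
Qed.

(** A constant [c] with [ln (h / mu) <= c (1 + |v|^2)] wherever [0 < h <= C]: it
adds up the logarithm of the bound, the normalisation of the Maxwellian and the
coefficient of [|v|^2] in its exponent. *)
Definition entropy_slope (C : R) : R :=
  ln (Num.max C 1) + `|ln Z| + (2 * sigma pr)^-1.

Lemma entropy_slope_ge0 C : 0 <= entropy_slope C.
Proof.
rewrite !addr_ge0// ?ln_ge0 ?le_max ?lexx ?orbT//.
by rewrite invr_ge0 mulr_ge0// ltW// sigma_gt0.
Qed.

Lemma entropy_density_le C z : h z.1 z.2 <= C ->
  F z <= entropy_slope C * ((1 + dot z.2 z.2) * h z.1 z.2).
Proof.
move=> hC; have [h00|hN0] := eqVneq (h z.1 z.2) 0; first by rewrite h00 mul0r !mulr0.
have hp : 0 < h z.1 z.2 by rewrite lt_neqAle eq_sym hN0 h0.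
rewrite mulrA [leRHS]mulrC ler_wpM2l//.
rewrite ln_div ?posrE// /maxwellian -/Z lnM ?posrE ?invr_gt0 ?expR_gt0// lnV ?posrE// expRK.
have lnC : ln (h z.1 z.2) <= ln (Num.max C 1).
  by rewrite ler_ln ?posrE ?lt_max ?ltr01 ?orbT// le_max hC.
have ln1 : 0 <= ln (Num.max C 1) by rewrite ln_ge0 ?le_max ?lexx ?orbT.
have d0 := dot_ge0 z.2; have lnZ := ler_norm (ln Z); have lnZ0 := normr_ge0 (ln Z).
have s0 : 0 <= (2 * sigma pr)^-1 by rewrite invr_ge0 mulr_ge0// ltW// sigma_gt0.
rewrite /entropy_slope; nra.
Qed.

Lemma entropy_density_ge z : - mu z.2 <= F z.
Proof.
have := dual_entropy_pointwise 0 (h0 z.1 z.2) (maxwellian_gt0 z.2).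
by rewrite add0r mulr1 expR0 mulr1; have := h0 z.1 z.2; lra.
Qed.

(** The negative part of the entropy density is at most the Maxwellian, and the
positive part at most a multiple of [(1 + |v|^2) h]. *)
Lemma entropy_integrable (C : R) :
  {ae leb2, forall z, h z.1 z.2 <= C} ->
  (\int[leb2]_(z in Ph) ((1 + dot z.2 z.2) * h z.1 z.2)%:E <= C%:E)%E ->
  leb2.-integrable Ph (EFin \o F) /\
  \int[leb2]_(z in Ph) F z <= entropy_slope C * C.
Proof.
move=> hC mom.
have mw : measurable_fun Ph (fun z => ((1 + dot z.2 z.2) * h z.1 z.2)%:E).
  apply: measurable_funTS; apply/measurable_EFinP; apply: measurable_funM => //.
  by apply: measurable_funD => //; exact: (measurableT_comp measurable_dot measurable_snd).
have w0 z : 0 <= (1 + dot z.2 z.2) * h z.1 z.2 by rewrite mulr_ge0// addr_ge0// dot_ge0.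
have up : (\int[leb2]_(z in Ph) (entropy_slope C * ((1 + dot z.2 z.2) * h z.1 z.2))%:E <=
    (entropy_slope C * C)%:E)%E.
  under eq_integral do rewrite EFinM.
  rewrite ge0_integralZl//=.
  - by rewrite EFinM lee_wpmul2l// lee_fin entropy_slope_ge0.
  - by move=> z _; rewrite lee_fin.
  - by rewrite lee_fin entropy_slope_ge0.
have muy : (\int[leb2]_(z in Ph) (mu z.2)%:E < +oo)%E.
  by have := integral_maxwellian_cst ler01; under eq_integral do rewrite mulr1; move=> ->; rewrite ltry.
have iF : leb2.-integrable Ph (EFin \o F).
  apply/integrableP; split; first by apply: measurable_funTS; exact/measurable_EFinP.
  apply: (@le_lt_trans _ _ (\int[leb2]_(z in Ph)
      ((entropy_slope C * ((1 + dot z.2 z.2) * h z.1 z.2))%:E + (mu z.2)%:E))%E).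
    apply: le_integral_ae; apply: filterS hC => z hC _.
    rewrite /= -EFinD lee_fin ler_norml; apply/andP; split.
      rewrite opprD; apply: le_trans (entropy_density_ge z).
      by rewrite gerDr oppr_le0 mulr_ge0// entropy_slope_ge0.
    by rewrite (le_trans (entropy_density_le hC))// lerDl ltW.
  rewrite ge0_integralD//.
  - by rewrite lte_add_pinfty// (le_lt_trans up)// ltry.
  - by move=> z _; rewrite lee_fin mulr_ge0// entropy_slope_ge0.
  - by under eq_fun do rewrite EFinM; exact: measurable_funeM.
  - by move=> z _; rewrite lee_fin ltW.
  - by apply: measurable_funTS; exact/measurable_EFinP.
split=> //; rewrite -lee_fin (le_trans _ up)// /Rintegral fineK; last exact: integrable_fin_num iF.
by apply: le_integral_ae; apply: filterS hC => z hC _; rewrite lee_fin entropy_density_le.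
Qed.

Lemma dual_entropy (Psi : E * E -> R) (K : R) :
  leb2.-integrable Ph (EFin \o F) ->
  measurable_fun setT Psi -> (forall z, 0 <= Psi z <= K) ->
  (\int[leb2]_(z in Ph) (h z.1 z.2 * Psi z)%:E + 1 <=
   (\int[leb2]_(z in Ph) F z)%:E + \int[leb2]_(z in Ph) (mu z.2 * expR (Psi z))%:E)%E.
Proof.
move=> iF mPsi Psi0K.
have Psi0 z : 0 <= Psi z by have /andP[] := Psi0K z.
have mhP : measurable_fun Ph (fun z => (h z.1 z.2 * Psi z)%:E).
  by apply: measurable_funTS; apply/measurable_EFinP; exact: measurable_funM.
have mhE : measurable_fun Ph (fun z => (h z.1 z.2)%:E).
  by apply: measurable_funTS; exact/measurable_EFinP.
have mm : measurable_fun Ph (fun z => (mu z.2 * expR (Psi z))%:E).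
  apply: measurable_funTS; apply/measurable_EFinP; apply: measurable_funM => //.
  exact: measurableT_comp.
rewrite -(kd_mass hh) -ge0_integralD//; last 2 first.
- by move=> z _; rewrite lee_fin mulr_ge0.
- by move=> z _; rewrite lee_fin.
have imu : leb2.-integrable Ph (fun z => (mu z.2 * expR (Psi z))%:E).
  apply/integrableP; split => //.
  apply: (@le_lt_trans _ _ (maxwellian_mass * (expR K * L ^+ n))%:E); last exact: ltry.
  rewrite -(integral_maxwellian_cst (expR_ge0 K)).
  apply: le_integral_pointwise => z _; have /andP[_ PK] := Psi0K z.
  rewrite /= ger0_norm; last by apply: mulr_ge0; [exact: ltW|exact: expR_ge0].
  by rewrite lee_fin ler_wpM2l ?ler_expR// ltW.
rewrite /Rintegral fineK; last exact: integrable_fin_num iF.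
rewrite -integralD//; apply: le_integral_pointwise => z _.
rewrite -!EFinD lee_fin -[X in _ + X <= _]mulr1 -mulrDr.
exact: dual_entropy_pointwise.
Qed.

End free_energy.

(** * Decay of the energy at every time *)

Section decay.
Context {R : realType} (B : R -> R) (hB : smooth_step B).
Local Notation leb1 := (@lebesgue_measure R).

(** Equal to [1] up to time [t] and to [0] from time [t + d] on. *)
Definition time_cutoff (t d s : R) : R := B (2 / d * (s - t) - 1).

Section cutoff.
Variables (t d : R) (t0 : 0 <= t) (d0 : 0 < d).
Local Notation phi := (time_cutoff t d).

Let k0 : 0 < 2 / d. Proof. by rewrite divr_gt0. Qed.

Let sB := step_smooth hB.

Lemma smooth_time_cutoff : smooth phi.
Proof.
apply: (@smooth_comp _ _ B (fun s => 2 / d * (s - t) - 1)) => //.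
apply: smoothB; last exact: smooth_cst.
by apply: smoothZ; apply: smoothB; [exact: smooth_id|exact: smooth_cst].
Qed.

Lemma derive1_time_cutoff s :
  derive1 phi s = 2 / d * derive1 B (2 / d * (s - t) - 1).
Proof.
pose a (s : R) := 2 / d * (s - t) - 1.
have Da : is_derive s (1 : R) a (2 / d).
  by apply: is_derive_eq; rewrite /GRing.scale /=; ring.
have dB : differentiable B (a s) by exact: smooth_differentiable.
have da : differentiable a s by apply/derivable1_diffP; exact: ex_derive.
by rewrite !derive1E (@derive_comp_real _ _ B a)// derive_val mulrC.
Qed.

Lemma time_cutoff_derive_le0 s : derive1 phi s <= 0.
Proof. by rewrite derive1_time_cutoff mulr_ge0_le0 ?(ltW k0)// step_derive_le0. Qed.

Lemma time_cutoff_derive0 s : s < t \/ t + d < s -> derive1 phi s = 0.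
Proof.
move=> h; rewrite derive1_time_cutoff (step_derive0 hB) ?mulr0//.
rewrite ler_normr; apply/orP; case: h => h; [right|left].
  rewrite opprB lerDl -mulrN mulr_ge0 ?(ltW k0)// opprB subr_ge0 ltW//.
rewrite lerBrDr -mulrA mulrC -mulrA; have : 1 <= d^-1 * (s - t).
  by rewrite mulrC ler_pdivlMr// mul1r; lra.
lra.
Qed.

Lemma time_cutoff_init : phi 0 = 1.
Proof.
by rewrite /time_cutoff (step_left hB)// sub0r mulrN lerBlDr addNr oppr_le0 mulr_ge0// ltW.
Qed.

Lemma time_cutoff_end s : t + d < s -> phi s = 0.
Proof.
move=> h; rewrite /time_cutoff (step_right hB)// lerBrDr -mulrA mulrC -mulrA.
have : 1 <= d^-1 * (s - t) by rewrite mulrC ler_pdivlMr// mul1r; lra.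
lra.
Qed.

Lemma integral_time_cutoff :
  (\int[leb1]_(s in `[0%R, +oo[) (- derive1 phi s)%:E = 1)%E.
Proof.
have dphi s : derivable phi s 1.
  by apply/derivable1_diffP/smooth_differentiable; exact: smooth_time_cutoff.
have cphi : continuous phi by exact/smooth_continuous/smooth_time_cutoff.
rewrite (@ge0_continuous_FTC2y _ _ (fun s => - phi s) _ 0).
- by rewrite time_cutoff_init sub0e EFinN oppeK.
- by move=> s _; rewrite oppr_ge0 time_cutoff_derive_le0.
- apply: continuous_subspaceT => s; apply: continuousN.
  have -> : derive1 phi = 'D_1 phi by apply/funext => x; rewrite derive1E.
  by apply: smooth_continuous; apply: smooth_derive; exact: smooth_time_cutoff.
- apply: cvg_near_cst; near=> s; rewrite time_cutoff_end ?oppr0//.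
  by near: s; exact: (nbhs_pinfty_gt (num_real _)).
- by move=> s _; exact: derivableN.
- by apply: cvg_at_right_filter; apply: continuousN; exact: cphi.
- by move=> s _; rewrite !derive1E deriveN.
Unshelve. all: by end_near. Qed.

End cutoff.

(** [A] stands for a continuous lower bound of the energy [En], which may be
irregular in time.  If [A t] exceeded [E0], then so would [En] almost
everywhere just after [t], in contradiction with the inequality tested on a
cutoff that decreases there. *)
Lemma le_of_decay (En Di A : R -> R) (E0 t : R) : 0 <= t ->
  (forall phi : R -> R, smooth phi -> (forall s, 0 <= s -> 0 <= phi s) ->
    (exists b, forall s, b < s -> phi s = 0) ->
    - (\int[leb1]_(s in `[0, +oo[) (En s * derive1 phi s)) - E0 * phi 0 <=
    - (\int[leb1]_(s in `[0, +oo[) (Di s * phi s))) ->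
  (forall T, 0 < T -> {ae leb1, forall s, 0 <= s < T -> 0 <= Di s}) ->
  (forall T, 0 < T -> exists C, {ae leb1, forall s, 0 <= s < T -> A s <= En s <= C}) ->
  (forall T, 0 < T -> {within `[0, T[, continuous A}) ->
  A t <= E0.
Proof.
move=> t0 decay Di0 EnA cA; rewrite leNgt; apply/negP => E0A.
(* any level strictly between [E0] and [A t] would do *)
pose c := (E0 + A t) / 2.
have Ec : E0 < c by rewrite /c; lra.
have cAt : c < A t by rewrite /c; lra.
have t1 : 0 < t + 1 by rewrite ltr_wpDl.
have [d [d0 d1 dA]] : exists d, [/\ 0 < d, d < 1 & forall s, t <= s <= t + d -> c <= A s].
  have tin : `[0, t + 1[%classic t by rewrite /= in_itv/= t0 ltrDl ltr01.
  have /subspace_continuousP/(_ _ tin) := cA _ t1.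
  move=> /cvgr_gt/(_ _ cAt)/nbhs_ballP[e /= e0 eA].
  have m0 : 0 < Num.min (e / 2) 2^-1 by rewrite lt_min divr_gt0//= invr_gt0.
  exists (Num.min (e / 2) 2^-1); split => //.
    by rewrite gt_min; apply/orP; right; rewrite invf_lt1// ltr1n.
  move=> s /andP[ts std].
  have [s1 s2] : s <= t + e / 2 /\ s <= t + 2^-1.
    by split; apply: (le_trans std); rewrite lerD2l ge_min lexx ?orbT.
  apply/ltW/eA; last by rewrite /= in_itv/=; apply/andP; split; lra.
  by rewrite /ball/= ltr_norml; apply/andP; split; lra.
pose phi := time_cutoff t d.
have phi0 s : 0 <= phi s by have /andP[] := step_itv hB (2 / d * (s - t) - 1).
have phib : exists b, forall s, b < s -> phi s = 0.
  by exists (t + d) => s; exact: time_cutoff_end.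
have := decay phi (smooth_time_cutoff t d) (fun s _ => phi0 s) phib.
rewrite (_ : phi 0 = 1) ?mulr1; last exact: time_cutoff_init.
have Dphi : 0 <= \int[leb1]_(s in `[0, +oo[) (Di s * phi s).
  rewrite fine_ge0// -(integral0 leb1 `[0, +oo[).
  apply: le_integral_ae; apply: ae_mono (Di0 _ t1) => s Ds.
  rewrite /= in_itv/= andbT => s0; rewrite lee_fin.
  have [st|ts] := ltP s (t + 1); first by rewrite mulr_ge0// Ds// s0.
  by rewrite /phi time_cutoff_end ?mulr0//; lra.
have [C EnC] := EnA _ t1.
pose e s := - derive1 phi s.
have e0 s : 0 <= e s by rewrite oppr_ge0; exact: time_cutoff_derive_le0.
have ie : leb1.-integrable `[0, +oo[ (EFin \o e).
  apply/integrableP; split.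
    apply: measurable_funTS; apply/measurable_EFinP; apply: measurableT_comp => //.
    apply: continuous_measurable_fun.
    have -> : derive1 phi = 'D_1 phi by apply/funext => x; rewrite derive1E.
    by apply: smooth_continuous; apply: smooth_derive; exact: smooth_time_cutoff.
  under eq_integral do rewrite /= ger0_norm//.
  by rewrite /e (integral_time_cutoff t0 d0) ltry.
have ieE a : (\int[leb1]_(s in `[0%R, +oo[) (a * e s)%:E = a%:E)%E.
  under eq_integral do rewrite EFinM.
  by rewrite integralZl//= /e (integral_time_cutoff t0 d0) mule1.
have lo : ((- C)%:E <= \int[leb1]_(s in `[0%R, +oo[) (En s * derive1 phi s)%:E)%E.
  rewrite -ieE; apply: le_integral_ae; apply: ae_mono EnC => s EnC.
  rewrite /= in_itv/= andbT => s0; rewrite lee_fin /e.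
  have [st|ts] := ltP s (t + 1).
    have /andP[_ EC] := EnC (introT andP (conj s0 st)).
    by rewrite mulrNN ler_wnM2r//; exact: time_cutoff_derive_le0.
  by rewrite /phi time_cutoff_derive0 ?oppr0 ?mulr0//; right; lra.
have up : (\int[leb1]_(s in `[0%R, +oo[) (En s * derive1 phi s)%:E <= (- c)%:E)%E.
  rewrite -ieE; apply: le_integral_ae; apply: ae_mono EnC => s EnC.
  rewrite /= in_itv/= andbT => s0; rewrite lee_fin /e mulrNN.
  have [st|ts] := ltP s t; first by rewrite /phi time_cutoff_derive0 ?mulr0//; left.
  have [dst|std] := ltP (t + d) s; first by rewrite /phi time_cutoff_derive0 ?mulr0//; right.
  have s1 : s < t + 1 by lra.
  have /andP[EA _] := EnC (introT andP (conj s0 s1)).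
  apply: ler_wnM2r; first exact: time_cutoff_derive_le0.
  by apply: le_trans EA; apply: dA; rewrite ts.
have : \int[leb1]_(s in `[0, +oo[) (En s * derive1 phi s) <= - c.
  rewrite -lee_fin /Rintegral fineK//.
  by rewrite fin_numE; apply/andP; split; apply/eqP => h; move: lo up; rewrite h.
move=> h1 h2; have h3 := le_trans h2 (eq_ind _ (fun b => is_true b) Dphi _ (esym (oppr_le0 _))).
have : c - E0 <= 0 by apply: le_trans h3; rewrite lerD2r lerNr.
by rewrite subr_le0 leNgt Ec.
Qed.

End decay.

Section solution.
Context {R : realType} {n : nat} {L : R} (L_gt0 : 0 < L).
Local Notation E := 'rV[R]_n.
Local Notation Om := (@cell R n L).
Local Notation Ph := (@cell R n L `*` [set: E]).
Local Notation leb1 := (@lebesgue_measure R).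
Local Notation leb := (@lebesgue_rV R n).
Local Notation leb2 := (@lebesgue_rV R n \x @lebesgue_rV R n)%E.
Variables (M : averaging_model R n L) (pr : params R n) (q : R).
Hypothesis q_ge2 : 2 <= q.
Local Notation mu := (maxwellian (L := L) pr).

Lemma moment_dot_lty (h : E -> E -> R) (C : R) : kinetic_density (L := L) h ->
  (norm_Lq (L := L) q h <= C%:E)%E ->
  (\int[leb2]_(z in Ph) (dot z.2 z.2 * h z.1 z.2)%:E < +oo)%E.
Proof.
move=> hh hC; apply: (@le_lt_trans _ _ C%:E); last exact: ltry.
apply: (le_trans _ (le_trans (moment_le_norm_Lq hh q_ge2) hC)).
apply: le_integral_pointwise => z _; rewrite lee_fin ler_wpM2r//; first exact: (kd_ge0 hh).
by rewrite lerDr.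
Qed.

Lemma integrable_exp_maxwellian (Psi : E * E -> R) (K : R) :
  measurable_fun setT Psi -> (forall z, 0 <= Psi z <= K) ->
  leb2.-integrable Ph (EFin \o (fun z => mu z.2 * expR (Psi z))).
Proof.
move=> mPsi Psi0K.
have m0 v : 0 <= mu v by apply/ltW/maxwellian_gt0.
apply/integrableP; split.
  apply: measurable_funTS; apply/measurable_EFinP; apply: measurable_funM.
    exact: (measurableT_comp (measurable_maxwellian pr) measurable_snd).
  exact: measurableT_comp.
apply: (@le_lt_trans _ _ (maxwellian_mass (L := L) pr * (expR K * L ^+ n))%:E); last exact: ltry.
rewrite -(integral_maxwellian_cst L_gt0 pr (expR_ge0 K)).
apply: le_integral_pointwise => z _; have /andP[_ PK] := Psi0K z.
rewrite /= ger0_norm; last by apply: mulr_ge0; [exact: m0|exact: expR_ge0].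
by rewrite lee_fin ler_wpM2l ?ler_expR//; exact: m0.
Qed.

Lemma integrable_density_bounded (h : E -> E -> R) (Psi : E * E -> R) (K : R) :
  kinetic_density (L := L) h ->
  measurable_fun setT Psi -> (forall z, 0 <= Psi z <= K) ->
  leb2.-integrable Ph (EFin \o (fun z => h z.1 z.2 * Psi z)).
Proof.
move=> hh mPsi Psi0K; have h0 := kd_ge0 hh; have mh := kd_measurable hh.
have K0 : 0 <= K by have /andP[] := Psi0K 0; exact: le_trans.
apply/integrableP; split.
  by apply: measurable_funTS; apply/measurable_EFinP; exact: measurable_funM.
apply: (@le_lt_trans _ _ (\int[leb2]_(z in Ph) (K%:E * (h z.1 z.2)%:E))%E).
  apply: le_integral_pointwise => z _; have /andP[P0 PK] := Psi0K z.
  by rewrite /= ger0_norm ?mulr_ge0// -EFinM lee_fin mulrC ler_wpM2r.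
rewrite ge0_integralZl//.
- by rewrite [X in (_ * X)%E](kd_mass hh) mule1 ltry.
- exact: measurable_phase.
- by apply: measurable_funTS; exact/measurable_EFinP.
- by move=> z _; rewrite lee_fin.
Qed.

(** The upper bound makes the time integral of the energy against a cutoff finite,
hence an honest one. *)
Lemma energy_bounds (h : E -> E -> R) (w : E -> E) (C C' : R) (Psi : E * E -> R) (K : R) :
  kinetic_density (L := L) h ->
  {ae leb2, forall z, h z.1 z.2 <= C} -> (norm_Lq (L := L) q h <= C%:E)%E ->
  (\int[leb]_(x in Om) (dot (w x) (w x))%:E <= C'%:E)%E ->
  measurable_fun setT Psi -> (forall z, 0 <= Psi z <= K) ->
  sigma pr * (\int[leb2]_(z in Ph) (h z.1 z.2 * Psi z) + 1 -
    \int[leb2]_(z in Ph) (mu z.2 * expR (Psi z))) <= energy (L := L) pr h w <=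
  sigma pr * (entropy_slope (n := n) (L := L) pr C * C) + beta pr / (2 * gamma pr) * C'.
Proof.
move=> hh hC hq wC mPsi Psi0K.
have s0 : 0 <= sigma pr := ltW (sigma_gt0 pr).
have bg0 : 0 <= beta pr / (2 * gamma pr).
  by rewrite divr_ge0 ?mulr_ge0 ?(ltW (beta_gt0 pr)) ?(ltW (gamma_gt0 pr)).
have [iF Fle] := entropy_integrable L_gt0 pr hh hC (le_trans (moment_le_norm_Lq hh q_ge2) hq).
have w0 : (0 <= \int[leb]_(x in Om) (dot (w x) (w x))%:E)%E.
  by apply: integral_ge0 => x _; rewrite lee_fin dot_ge0.
have wfin : (\int[leb]_(x in Om) (dot (w x) (w x))%:E)%E \is a fin_num.
  by rewrite ge0_fin_numE// (le_lt_trans wC)// ltry.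
apply/andP; split.
  rewrite -[leLHS]addr0; apply: lerD; last by rewrite mulr_ge0// fine_ge0.
  rewrite ler_wpM2l// lerBlDr.
  have := dual_entropy L_gt0 hh iF mPsi Psi0K.
  have i1 := integrable_density_bounded hh mPsi Psi0K.
  have i2 := integrable_exp_maxwellian mPsi Psi0K.
  rewrite -lee_fin !EFinD /Rintegral !fineK//; apply: integrable_fin_num => //; exact: measurable_phase.
apply: lerD; first by rewrite ler_wpM2l.
by rewrite ler_wpM2l// -lee_fin /Rintegral fineK.
Qed.

Section gibbs.
Variables (B : R -> R) (hB : smooth_step B).
Hypotheses (M_regular : regular M) (M_conservative : conservative M).
Variables (f0 : E -> E -> R) (u0 : E -> E) (f : R -> E -> E -> R) (u : R -> E -> E).
Hypothesis sol : leray_hopf_solution M pr q f0 u0 f u.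

Lemma solution_kinetic_density s : 0 <= s -> kinetic_density (L := L) (f s).
Proof.
move=> s0; split.
- have mD : measurable [set z : R * E * E | 0 <= z.1.1].
    rewrite (_ : [set z | _] = (fun z : R * E * E => z.1.1) @^-1` `[0, +oo[%classic).
      rewrite -[X in measurable X]setTI.
      by apply: (measurableT_comp measurable_fst measurable_fst).
    by apply/seteqP; split => z /=; rewrite in_itv/= andbT.
  rewrite (_ : (fun z => _) = (fun z : R * E * E => f z.1.1 z.1.2 z.2) \o
    (fun z : E * E => ((s, z.1), z.2)))//.
  apply: (measurable_comp mD _ (lh_f_measurable sol)) => [_ [z _ <-] //=|].
  apply/measurable_fun_pairP; split => /=; last exact: measurable_snd.
  by apply/measurable_fun_pairP; split => /=; [exact: measurable_cst|exact: measurable_fst].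
- exact: (lh_f_periodic sol s0).
- by move=> x v; exact: (lh_f_ge0 sol _ _ s0).
- exact: (lh_f_mass sol s0).
Qed.

(** The distributional energy inequality turned into a bound at every time; this
is where the continuity of [f] as a distribution enters. *)
Lemma gibbs_bound (Psi : E * E -> R) (K t : R) : 0 <= t ->
  test_xv (L := L) Psi -> measurable_fun setT Psi -> (forall z, 0 <= Psi z <= K) ->
  \int[leb2]_(z in Ph) (f t z.1 z.2 * Psi z) + 1 <=
  energy (L := L) pr f0 u0 / sigma pr + \int[leb2]_(z in Ph) (mu z.2 * expR (Psi z)).
Proof.
move=> t0 tPsi mPsi Psi0K.
have [G [H [_ _ _ _ en]]] := lh_weak_derivatives sol.
set J := \int[leb2]_(z in Ph) (mu z.2 * expR (Psi z)).
pose A s := sigma pr * (\int[leb2]_(z in Ph) (f s z.1 z.2 * Psi z) + 1 - J).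
suff : A t <= energy (L := L) pr f0 u0.
  by rewrite /A mulrC -ler_pdivlMr ?sigma_gt0// lerBlDr.
apply: (le_of_decay hB t0 en).
- move=> T T0; have [C fC] := lh_f_Loo sol T0.
  apply: ae_mono fC => s fC s0T; have /andP[s0 _] := s0T; have [_ fq] := fC s0T.
  have kd := solution_kinetic_density s0.
  apply: dissipation_ge0 => //; exact: (moment_dot_lty kd fq).
- move=> T T0; have [C fC] := lh_f_Loo sol T0; have [C' uC] := lh_u_LooL2 sol T0.
  exists (sigma pr * (entropy_slope (n := n) (L := L) pr C * C) + beta pr / (2 * gamma pr) * C').
  apply: ae_mono2 fC uC => s fC uC s0T; have /andP[s0 _] := s0T; have [fb fq] := fC s0T.
  exact: (energy_bounds (solution_kinetic_density s0) fb fq (uC s0T) mPsi Psi0K).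
- move=> T T0; have cf := lh_f_continuous sol T0 tPsi.
  have cg : continuous (fun y : R => sigma pr * (y + 1 - J)).
    apply: smooth_continuous; apply: smoothZ; apply: smoothB; last exact: smooth_cst.
    by apply: smoothD; [exact: smooth_id|exact: smooth_cst].
  have -> : A = (fun y : R => sigma pr * (y + 1 - J)) \o
    (fun s => \int[leb2]_(z in Ph) (f s z.1 z.2 * Psi z)) by [].
  move=> s; apply: (@continuous_comp (subspace `[0, T[) _ _ _ _ s (cf s)).
  exact: cg.
Qed.

End gibbs.
End solution.

(** * The positive part of the spatial entropy *)

Section spatial_entropy.
Context {R : realType} {n : nat} {L : R} (L_gt0 : 0 < L).
Local Notation E := 'rV[R]_n.
Local Notation Om := (@cell R n L).
Local Notation Ph := (@cell R n L `*` [set: E]).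
Local Notation leb := (@lebesgue_rV R n).
Local Notation leb2 := (@lebesgue_rV R n \x @lebesgue_rV R n)%E.
Variables (pr : params R n) (B : R -> R) (hB : smooth_step B).
Local Notation mu := (maxwellian (L := L) pr).
Local Notation G := (maxwellian_mass (L := L) pr).
Variables (h : E -> E -> R) (hh : kinetic_density (L := L) h) (H : R).
Hypothesis gibbs : forall (Psi : E * E -> R) (K : R),
  test_xv (L := L) Psi -> measurable_fun setT Psi -> (forall z, 0 <= Psi z <= K) ->
  \int[leb2]_(z in Ph) (h z.1 z.2 * Psi z) + 1 <=
  H + \int[leb2]_(z in Ph) (mu z.2 * expR (Psi z)).

Let mOm : measurable Om := @measurable_cell R n L.
Let mPh : measurable Ph := measurable_phase.
Let rho0 := rho_ge0 hh.
Let mrho := measurable_rho hh.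
Let G0 : 0 <= G := maxwellian_mass_ge0 L_gt0 pr.

Let mexp (g : E -> R) : measurable_fun setT g -> measurable_fun Om (fun x => (expR (g x))%:E).
Proof.
by move=> mg; apply: measurable_funTS; apply/measurable_EFinP; exact: measurableT_comp.
Qed.

(** The cutoff in velocity is removed by dominated convergence on the left-hand
side, whereas on the right-hand side it may be dropped at once since it only
decreases the exponential. *)
Lemma spatial_dual_test (psi : E -> R) (K : R) : test_x (L := L) psi ->
  (forall x, 0 <= psi x <= K) ->
  (\int[leb]_(x in Om) (psi x * rho h x)%:E + 1 <=
   H%:E + G%:E * \int[leb]_(x in Om) (expR (psi x))%:E)%E.
Proof.
move=> tpsi psi0K; have mpsi := test_x_measurable tpsi.
have psi0 x : 0 <= psi x by have /andP[] := psi0K x.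
have h0 := kd_ge0 hh; have mh := kd_measurable hh.
(* equal to [1] where [|v|^2 <= k - 1], to [0] where [|v|^2 >= k + 1] *)
pose chi (k : nat) (v : E) := B (dot v v - k%:R).
have chi01 k v : 0 <= chi k v <= 1 by exact: step_itv.
pose Psi k (z : E * E) := psi z.1 * chi k z.2.
have mpsi1 : measurable_fun setT (fun z : E * E => psi z.1).
  exact: (measurableT_comp mpsi measurable_fst).
have schi k : smooth (chi k).
  apply: (@smooth_comp _ _ B (fun v => dot v v - k%:R)); first exact: step_smooth.
  by apply: smoothB; [exact: smooth_dot|exact: smooth_cst].
have mPsi k : measurable_fun setT (Psi k).
  apply: measurable_funM => //; apply: (measurableT_comp _ measurable_snd).
  by apply: continuous_measurable_rV; exact: smooth_continuous.
have Psi_psi k z : 0 <= Psi k z <= psi z.1.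
  by have /andP[c0 c1] := chi01 k z.2; rewrite mulr_ge0//= ler_piMr.
have Psi0K k z : 0 <= Psi k z <= K.
  by have /andP[-> /le_trans->] := Psi_psi k z => //; have /andP[] := psi0K z.1.
have tPsi k : test_xv (L := L) (Psi k).
  split.
  - apply: smoothM; first by apply: smooth_fst; exact: tpsi.1.
    exact: smooth_snd.
  - by move=> v j x; rewrite /Psi /= tpsi.2.
  - exists (Num.sqrt (k%:R + 1)) => x v; rewrite mulf_eq0 negb_or => /andP[_ chiN0].
    rewrite ler_sqrt ?addr_ge0// leNgt; apply: contra chiN0 => kv.
    by rewrite /chi (step_right hB)//; lra.
have ik k := integrable_density_bounded hh (mPsi k) (Psi0K k).
have iexp := integrable_exp_maxwellian L_gt0 pr mpsi1 (fun z => psi0K z.1).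
set J := \int[leb2]_(z in Ph) (mu z.2 * expR (psi z.1)) in iexp *.
have JE : J%:E = (G%:E * \int[leb]_(x in Om) (expR (psi x))%:E)%E.
  rewrite /J /Rintegral fineK; last exact: integrable_fin_num iexp.
  apply: (integral_maxwellian L_gt0 pr (g := fun x => expR (psi x))).
    exact: measurableT_comp.
  by move=> x; exact: expR_ge0.
have bound k : (\int[leb2]_(z in Ph) (h z.1 z.2 * Psi k z)%:E <= (H + J - 1)%:E)%E.
  rewrite -(fineK (x := \int[leb2]_(z in Ph) _)%E); last exact: integrable_fin_num (ik k).
  rewrite lee_fin lerBrDr (le_trans (gibbs (tPsi k) (mPsi k) (Psi0K k)))// lerD2l.
  apply: le_Rintegral => //.
    exact: (integrable_exp_maxwellian L_gt0 pr (mPsi k) (Psi0K k)).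
  move=> z _; have /andP[_ Pp] := Psi_psi k z.
  by rewrite ler_wpM2l ?ler_expR//; apply/ltW/maxwellian_gt0.
have lim_h : (\int[leb2]_(z in Ph) (h z.1 z.2 * Psi k z)%:E)%E @[k --> \oo] -->
    (\int[leb2]_(z in Ph) (h z.1 z.2 * psi z.1)%:E)%E.
  apply: (@dominated_cvg _ _ _ _ _ mPh _ _ (fun z => (h z.1 z.2 * psi z.1)%:E)) => //.
  - move=> k; exact: measurable_int (ik k).
  - move=> z _; apply: cvg_near_cst; near=> k.
    rewrite /Psi /chi (step_left hB) ?mulr1// lerBlDr -lerBlDl opprK.
    by near: k; exact: nbhs_infty_ger.
  - exact: (integrable_density_bounded hh mpsi1 (fun z => psi0K z.1)).
  - move=> k z _; have /andP[P0 Pp] := Psi_psi k z.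
    rewrite /= lee_fin ger0_norm; last exact: mulr_ge0.
    by rewrite ler_wpM2l.
have -> : (\int[leb]_(x in Om) (psi x * rho h x)%:E =
    \int[leb2]_(z in Ph) (h z.1 z.2 * psi z.1)%:E)%E.
  under eq_integral do rewrite EFinM.
  rewrite (integral_rho hh (g := fun x => (psi x)%:E)).
  - by apply: eq_integral => z _; rewrite -EFinM mulrC.
  - exact/measurable_EFinP.
  - by move=> x; rewrite lee_fin.
rewrite -JE -EFinD -leeBrDr// -EFinB.
rewrite -(cvg_lim _ lim_h)//; apply: lime_le; first by apply/cvg_ex; eexists; exact: lim_h.
exact: nearW.
Unshelve. all: by end_near. Qed.

Let V : R := vol (n := n) L.
Let V0 : 0 < V := vol_gt0 L_gt0.
Let one_rho x : R := 1 + rho h x.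
Let mone_rho : measurable_fun setT one_rho.
Proof. exact: measurable_funD. Qed.
Let one_rho0 x : 0 <= one_rho x.
Proof. by rewrite addr_ge0. Qed.

Lemma integral_one_rho : (\int[leb]_(x in Om) (one_rho x)%:E = (1 + V)%:E)%E.
Proof.
under eq_integral do rewrite EFinD.
rewrite ge0_integralD//; last 2 first.
- by move=> x _; rewrite lee_fin.
- by apply: measurable_funTS; exact/measurable_EFinP.
have [_ _ _ ->] := rho_density hh.
have -> : (\int[leb]_(x in Om) 1%:E = (L ^+ n)%:E)%E.
  by rewrite -(lebesgue_cell L_gt0) -[RHS]mul1e; exact: (integral_cst leb mOm 1%E).
by rewrite -(volE L_gt0) -EFinD addrC.
Qed.

Let mix x : R := (1 + V)^-1 * one_rho x.

(** Approximation in [L^1] of this single probability measure is approximation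
in both [L^1(dx)] and [L^1(rho dx)]. *)
Lemma mix_density : is_density L mix.
Proof.
have iV : 0 <= (1 + V)^-1 by rewrite invr_ge0 addr_ge0// ltW.
split.
- by apply: measurable_funM.
- by move=> k x; rewrite /mix /one_rho; have [_ -> _ _] := rho_density hh.
- by move=> x; rewrite mulr_ge0.
- under eq_integral do rewrite EFinM.
  rewrite ge0_integralZl//.
  + by rewrite integral_one_rho -EFinM mulVf// gt_eqF// addr_gt0.
  + by apply: measurable_funTS; exact/measurable_EFinP.
  + by move=> x _; rewrite lee_fin.
Qed.

Lemma integral_mix (f : E -> R) : measurable_fun setT f -> (forall x, 0 <= f x) ->
  (\int[law L mix]_(x in Om) (f x)%:E =
   ((1 + V)^-1)%:E * \int[leb]_(x in Om) (f x * one_rho x)%:E)%E.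
Proof.
move=> mf f0; have mfE : measurable_fun setT (fun x => (f x)%:E) by exact/measurable_EFinP.
rewrite integral_mkcond (ge0_integral_law mix_density); last 2 first.
- by apply/(measurable_restrictT _ _).1 => //; exact: measurable_funTS.
- by apply: erestrict_ge0 => x _; rewrite lee_fin.
rewrite -ge0_integralZl//.
- by apply: eq_integral => x xO; rewrite patchE xO -!EFinM mulrCA.
- apply: measurable_funTS; apply/measurable_EFinP; exact: measurable_funM.
- by move=> x _; rewrite lee_fin mulr_ge0.
- by rewrite lee_fin invr_ge0 addr_ge0// ltW.
Qed.

Import HBNNSimple.

(** The exponential is convex, so replacing [g] by an approximant [psi <= K]
costs at most [e^K |g - psi|] in the integral of the exponential. *)
Lemma spatial_dual_simple (g : {nnsfun E >-> R}) :
  (\int[leb]_(x in Om) (g x * rho h x)%:E + 1 <=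
   H%:E + G%:E * \int[leb]_(x in Om) (expR (g x))%:E)%E.
Proof.
have mg : measurable_fun setT g by [].
have g0 x : 0 <= g x by [].
have [K gK] := nnsfun_L1_approx L_gt0 hB (law L mix) g.
apply/lee_addgt0Pr => e e0.
(* [1 + V] turns the probability back into [(1 + rho) dx]; the other factor
   collects the errors made on the two sides of the inequality *)
pose c := (1 + V) * (1 + G * expR K).
have c1 : 0 < 1 + G * expR K by rewrite ltr_pwDl// mulr_ge0// expR_ge0.
have c0 : 0 < c by rewrite mulr_gt0// addr_gt0.
have [psi [tpsi psi0K dist]] := gK (e / c) (divr_gt0 e0 c0).
have mpsi := test_x_measurable tpsi.
have psi0 x : 0 <= psi x by have /andP[] := psi0K x.
pose d x := `|g x - psi x|.
have md : measurable_fun setT d.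
  by apply: measurableT_comp => //; exact: measurable_funB.
have d0 x : 0 <= d x by exact: normr_ge0.
pose del := e / (1 + G * expR K).
have dist1 : (\int[leb]_(x in Om) (d x * one_rho x)%:E <= del%:E)%E.
  move: dist; rewrite integral_mix// => dist.
  have V1 : 0 < 1 + V by rewrite addr_gt0.
  rewrite -[leLHS]mul1e -(@mulVf _ (1 + V)) ?gt_eqF// mulrC EFinM -muleA.
  apply: (le_trans (lee_wpmul2l _ dist)); first by rewrite lee_fin ltW.
  have fe (a b : R) : 0 < a -> 0 < b -> a * (e / (a * b)) = e / b.
    by move=> a0 b0; field; rewrite !gt_eqF.
  by rewrite -EFinM lee_fin /del /c fe.
have mOrho : measurable_fun Om (fun x => (psi x * rho h x)%:E).
  by apply: measurable_funTS; apply/measurable_EFinP; exact: measurable_funM.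
have mOd : measurable_fun Om (fun x => (d x * one_rho x)%:E).
  by apply: measurable_funTS; apply/measurable_EFinP; exact: measurable_funM.
have le1 : (\int[leb]_(x in Om) (g x * rho h x)%:E <=
    \int[leb]_(x in Om) (psi x * rho h x)%:E + del%:E)%E.
  apply: (le_trans _ (leeD2l _ dist1)).
  rewrite -ge0_integralD//; last 2 first.
  - by move=> x _; rewrite lee_fin mulr_ge0.
  - by move=> x _; rewrite lee_fin mulr_ge0.
  apply: le_integral_pointwise => x _; rewrite -EFinD lee_fin.
  have gd : g x <= psi x + d x by rewrite -lerBlDl ler_norm.
  apply: (le_trans (ler_wpM2r (rho0 x) gd)); rewrite mulrDl lerD2l ler_wpM2l//.
  by rewrite lerDr.
have le2 : (\int[leb]_(x in Om) (expR (psi x))%:E <=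
    \int[leb]_(x in Om) (expR (g x))%:E + (expR K)%:E * del%:E)%E.
  apply: (le_trans _ (leeD2l _ (lee_wpmul2l _ dist1))); last by rewrite lee_fin expR_ge0.
  rewrite -ge0_integralZl//; last by move=> x _; rewrite lee_fin mulr_ge0.
  rewrite -ge0_integralD//; last 3 first.
  - exact: mexp.
  - by move=> x _; rewrite -EFinM lee_fin mulr_ge0 ?expR_ge0// mulr_ge0.
  - by apply: measurable_funeM.
  apply: le_integral_pointwise => x _; rewrite -EFinM -EFinD lee_fin.
  have eE : expR (psi x) * expR (g x - psi x) = expR (g x) by rewrite -expRD subrKC.
  have := ler_wpM2l (expR_ge0 (psi x)) (expR_ge1Dx (g x - psi x)).
  rewrite [X in _ <= X -> _]eE => conv.
  have eK : expR (psi x) <= expR K by rewrite ler_expR; have /andP[] := psi0K x.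
  have pd : psi x - g x <= d x by rewrite /d distrC ler_norm.
  have dd : d x <= d x * one_rho x by rewrite ler_peMr// lerDl.
  have s1 : expR (psi x) * (psi x - g x) <= expR (psi x) * d x by rewrite ler_wpM2l// expR_ge0.
  have s2 : expR (psi x) * d x <= expR K * d x by rewrite ler_wpM2r.
  have s3 : expR K * d x <= expR K * (d x * one_rho x) by rewrite ler_wpM2l// expR_ge0.
  by lra.
apply: (le_trans (leeD2r _ le1)); rewrite -addeA [(del%:E + _)%E]addeC addeA.
apply: (le_trans (leeD2r _ (spatial_dual_test tpsi psi0K))).
rewrite -!addeA leeD2l//.
apply: (le_trans (leeD2r _ (lee_wpmul2l _ le2))); first by rewrite lee_fin.
rewrite ge0_muleDr//; last 2 first.
- by apply: integral_ge0 => x _; rewrite lee_fin expR_ge0.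
- by rewrite -EFinM lee_fin mulr_ge0 ?expR_ge0// divr_ge0// ltW.
rewrite -addeA leeD2l// -!EFinM -EFinD lee_fin.
rewrite mulrA -[X in _ + X <= _]mul1r -mulrDl addrC.
by rewrite /del mulrC divfK// gt_eqF.
Qed.

(** Simple functions increasing to the positive part of [ln rho] have an
exponential below [1 + rho], whose integral is known. *)
Lemma positive_entropy_bound :
  (\int[leb]_(x in Om) (Num.max (ln (rho h x)) 0 * rho h x)%:E <=
   (H + G * (1 + V) - 1)%:E)%E.
Proof.
pose lp x : R := Num.max (ln (rho h x)) 0.
have mlp : measurable_fun setT lp.
  by apply: measurable_maxr => //; exact: measurableT_comp.
have mlpE : measurable_fun setT (fun x => (lp x)%:E) by exact/measurable_EFinP.
have lp0 x : (0 <= (lp x)%:E)%E by rewrite lee_fin le_max lexx orbT.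
pose g := nnsfun_approx measurableT mlpE.
have gle k x : g k x <= lp x.
  rewrite -lee_fin /g nnsfun_approxE.
  exact: (le_approx k (fun y _ => lp0 y) I).
have bound k : (\int[leb]_(x in Om) (g k x * rho h x)%:E <= (H + G * (1 + V) - 1)%:E)%E.
  rewrite EFinB leeBrDr// (le_trans (spatial_dual_simple (g k)))// EFinD leeD2l// EFinM.
  rewrite lee_wpmul2l ?lee_fin// -integral_one_rho; apply: le_integral_pointwise => x _.
  rewrite lee_fin; apply: (@le_trans _ _ (expR (lp x))); first by rewrite ler_expR gle.
  rewrite /lp /one_rho; have [l|l] := leP (ln (rho h x)) 0.
    by rewrite expR0 lerDl.
  have rp : 0 < rho h x.
    by rewrite ltNge; apply/negP => r0; move: l; rewrite ln0// ltxx.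
  by rewrite lnK ?posrE// lerDr.
have gcvg x : Om x -> (g k x * rho h x)%:E @[k --> \oo] --> (lp x * rho h x)%:E.
  move=> _; rewrite EFinM; under eq_fun do rewrite EFinM.
  by apply: cvgeZr => //; exact: cvg_nnsfun_approx.
have lim : (\int[leb]_(x in Om) (g k x * rho h x)%:E)%E @[k --> \oo] -->
    (\int[leb]_(x in Om) (lp x * rho h x)%:E)%E.
  rewrite (_ : (\int[leb]_(x in Om) (lp x * rho h x)%:E)%E =
    (\int[leb]_(x in Om) limn (fun k => (g k x * rho h x)%:E))%E); last first.
    by apply: eq_integral => x; rewrite inE => /gcvg/cvg_lim ->.
  apply: cvg_monotone_convergence => //.
  - by move=> k; apply: measurable_funTS; apply/measurable_EFinP; exact: measurable_funM.
  - by move=> k x _; rewrite lee_fin mulr_ge0.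
  - by move=> x _ a b ab; rewrite lee_fin ler_wpM2r//; exact/lefP/nd_nnsfun_approx.
rewrite -(cvg_lim _ lim)//; apply: lime_le; first by apply/cvg_ex; eexists; exact: lim.
exact: nearW.
Qed.


End spatial_entropy.

(** * Entropy and level sets *)

Section density_entropy.
Context {R : realType} {n : nat} {L : R} (L_gt0 : 0 < L).
Local Notation E := 'rV[R]_n.
Local Notation Om := (@cell R n L).
Local Notation leb := (@lebesgue_rV R n).
Variables (r : E -> R) (dr : is_density L r) (K : R) (K0 : 0 < K).
Hypothesis ent : (\int[leb]_(x in Om) (Num.max (ln (r x)) 0 * r x)%:E <= K%:E)%E.

Let V : R := vol (n := n) L.
Let V0 : 0 < V := vol_gt0 L_gt0.
Let mOm : measurable Om := @measurable_cell R n L.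
Let mr : measurable_fun setT r. Proof. by have [] := dr. Qed.
Let r0 x : 0 <= r x. Proof. by have [_ _ ->] := dr. Qed.

Let cst_integral (a : R) : (\int[leb]_(x in Om) a%:E = (a * V)%:E)%E.
Proof.
rewrite (integral_cst leb mOm a%:E : (\int[leb]_(x in Om) a%:E = _)%E).
by rewrite EFinM /V (volE L_gt0); congr (_ * _)%E; exact: lebesgue_cell.
Qed.

(** The lower bound is [r ln r >= - 1]. *)
Lemma entropy_abs_le :
  (`| \int[leb]_(x in Om) (r x * ln (r x))%:E | <= (Num.max K V)%:E)%E.
Proof.
have up : (\int[leb]_(x in Om) (r x * ln (r x))%:E <= K%:E)%E.
  apply: le_trans ent; apply: le_integral_pointwise => x _.
  by rewrite lee_fin mulrC ler_wpM2r// le_max lexx.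
have lo : ((- V)%:E <= \int[leb]_(x in Om) (r x * ln (r x))%:E)%E.
  rewrite -[V]mul1r -mulNr -cst_integral; apply: le_integral_pointwise => x _.
  have := dual_entropy_pointwise (- 1) (r0 x) (@ltr01 R).
  rewrite lee_fin addNr mulr0 divr1 mul1r => h.
  have : expR (- 1) <= 1 :> R by rewrite expR_le1 oppr_le0.
  by lra.
move: up lo; case: (\int[leb]_(x in Om) _)%E => [a| |]//=.
rewrite !lee_fin => aK Va; rewrite ler_norml le_max aK orTb andbT.
by rewrite (le_trans _ Va)// lerN2 le_max lexx orbT.
Qed.

(** The mass where [r] is below the first threshold or above [e^(4 K)] is at
most one half. *)
Lemma level_set_lower_bound :
  (((2 * expR (4 * K))^-1)%:E <=
   leb (Om `&` [set x | ((4 * V)^-1 <= r x)%R]))%E.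
Proof.
set c1 := (4 * V)^-1; set m := expR (4 * K).
have m0 : 0 < m by exact: expR_gt0.
have c10 : 0 < c1 by rewrite invr_gt0 mulr_gt0.
pose A := [set x : E | c1 <= r x].
have mA : measurable A.
  rewrite (_ : A = r @^-1` `[c1, +oo[%classic).
    by rewrite -[X in measurable X]setTI; exact: mr.
  by apply/seteqP; split => x; rewrite /A /= in_itv/= andbT.
have K4 : 0 < 4 * K by rewrite mulr_gt0.
pose lp x := Num.max (ln (r x)) 0.
have lp0 x : 0 <= lp x by rewrite le_max lexx orbT.
have mlp : measurable_fun setT lp.
  by apply: measurable_maxr => //; exact: measurableT_comp.
(* above [m] the logarithm is at least [4 K]; between [c1] and [m] the last
   term dominates *)
have ptw x : r x <= c1 + (4 * K)^-1 * (lp x * r x) + m * \1_A x.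
  have K4V : 0 < (4 * K)^-1 by rewrite invr_gt0.
  have lpr : 0 <= (4 * K)^-1 * (lp x * r x) by rewrite mulr_ge0 ?mulr_ge0// ltW.
  rewrite indicE; have [xA|xA] := boolP (x \in A); last first.
    move: xA; rewrite notin_setE /A/= => /negP; rewrite -ltNge mulr0 addr0 => rc.
    by rewrite (le_trans (ltW rc))// lerDl.
  rewrite mulr1; have [rm|mr'] := leP (r x) m.
    by rewrite (le_trans rm)// lerDr addr_ge0// ltW.
  have rp : 0 < r x by exact: lt_trans mr'.
  have lr : 4 * K <= lp x.
    by rewrite le_max -[4 * K]expRK ler_ln ?posrE// (ltW mr').
  have : r x <= (4 * K)^-1 * (lp x * r x).
    by rewrite mulrA ler_peMl// mulrC ler_pdivlMr// mul1r.
  by move/le_trans; apply; rewrite -addrA addrCA lerDl addr_ge0// ltW.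
have tot : (1 <= (4^-1)%:E + (4^-1)%:E + m%:E * leb (Om `&` A))%E.
  have [_ _ _ <-] := dr.
  apply: (@le_trans _ _ (\int[leb]_(x in Om)
    (c1%:E + ((4 * K)^-1)%:E * (lp x * r x)%:E + m%:E * (\1_A x)%:E))%E).
    by apply: le_integral_pointwise => x _; rewrite -!EFinM -!EFinD lee_fin ptw.
  have mlr : measurable_fun Om (fun x => (lp x * r x)%:E).
    by apply: measurable_funTS; apply/measurable_EFinP; exact: measurable_funM.
  have m1A : measurable_fun Om (fun x => (\1_A x)%:E : \bar R).
    by apply: measurable_funTS; apply/measurable_EFinP; exact: measurable_indic.
  have K4V : 0 <= (4 * K)^-1 by rewrite invr_ge0 ltW.
  have t2 x : (0 <= ((4 * K)^-1)%:E * (lp x * r x)%:E)%E by rewrite -EFinM lee_fin mulr_ge0// mulr_ge0.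
  rewrite ge0_integralD//; last 4 first.
  - by move=> x _; rewrite adde_ge0// lee_fin ltW.
  - by apply: emeasurable_funD => //; exact: measurable_funeM.
  - by move=> x _; rewrite -EFinM lee_fin mulr_ge0// ltW.
  - exact: measurable_funeM.
  rewrite ge0_integralD//; last 2 first.
  - by move=> x _; rewrite lee_fin ltW.
  - exact: measurable_funeM.
  rewrite ge0_integralZl//; last by move=> x _; rewrite lee_fin mulr_ge0.
  rewrite ge0_integralZl//; last by rewrite lee_fin ltW.
  rewrite integral_indic// setIC cst_integral.
  rewrite leeD2r// leeD//.
    by rewrite lee_fin /c1 invfM -mulrA mulVf ?mulr1// gt_eqF.
  apply: (le_trans (lee_wpmul2l _ ent)); first by rewrite lee_fin.
  by rewrite -EFinM lee_fin invfM -mulrA mulVf ?mulr1// gt_eqF.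
move: tot; case: (leb (Om `&` A)) => [a| |]; last 2 first.
- by rewrite leey.
- by rewrite mulrNy gtr0_sg// mul1e addeNy.
rewrite -EFinM -!EFinD !lee_fin => h.
rewrite invfM mulrC ler_pdivrMl//; lra.
Qed.

End density_entropy.

Theorem lemma3p3 (R : realType) (n : nat) (n_gt0 : (0 < n)%N)
    (L : R) (L_gt0 : 0 < L)
    (M : averaging_model R n L)
    (M_regular : regular M) (M_schur : schur_class M)
    (M_conservative : conservative M)
    (pr : params R n) (q : R) (q_ge2 : 2 <= q)
    (f0 : 'rV[R]_n -> 'rV[R]_n -> R) (u0 : 'rV[R]_n -> 'rV[R]_n)
    (data0 : initial_data (L := L) q f0 u0) :
  exists c1 c2 : R, [/\ 0 < c1, 0 < c2 &
    forall (f : R -> 'rV[R]_n -> 'rV[R]_n -> R) (u : R -> 'rV[R]_n -> 'rV[R]_n),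
      leray_hopf_solution M pr q f0 u0 f u ->
      (exists C : R, forall t : R, 0 <= t ->
        (`| \int[lebesgue_rV n]_(x in cell L)
              (rho (f t) x * ln (rho (f t) x))%:E | <= C%:E)%E) /\
      (forall t : R, 0 <= t ->
        (c2%:E <= lebesgue_rV n (cell L `&` [set x | c1 <= rho (f t) x]%R))%E)].
Proof.
have [B hB] := mollifier_smooth_step n_gt0 (eta_mollifier pr).
pose V : R := vol (n := n) L.
pose K0 := energy (L := L) pr f0 u0 / sigma pr +
  maxwellian_mass (L := L) pr * (1 + V) - 1.
pose K := Num.max K0 0 + 1.
have K_gt0 : 0 < K by rewrite ltr_wpDl// le_max lexx orbT.
have V0 : 0 < V := vol_gt0 L_gt0.
exists (4 * V)^-1, (2 * expR (4 * K))^-1; split.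
- by rewrite invr_gt0 mulr_gt0.
- by rewrite invr_gt0 mulr_gt0// expR_gt0.
move=> f u sol.
have dr t : 0 <= t -> is_density L (rho (f t)).
  by move=> t0; apply: rho_density; exact: solution_kinetic_density sol _ t0.
have ent t : 0 <= t -> (\int[lebesgue_rV n]_(x in cell L)
    (Num.max (ln (rho (f t) x)) 0 * rho (f t) x)%:E <= K%:E)%E.
  move=> t0; apply: (@le_trans _ _ K0%:E); last first.
    by rewrite lee_fin /K (le_trans (_ : K0 <= Num.max K0 0))// ?lerDl// le_max lexx.
  apply: (positive_entropy_bound L_gt0 hB (solution_kinetic_density sol t0)).
  move=> Psi K' tPsi mPsi Psi0K.
  exact: (gibbs_bound L_gt0 q_ge2 hB M_regular M_conservative sol t0 tPsi mPsi Psi0K).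
split.
- exists (Num.max K V) => t t0.
  by apply: entropy_abs_le => //; [exact: dr|exact: ent].
- by move=> t t0; apply: level_set_lower_bound => //; [exact: dr|exact: ent].
Qed.
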